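(* Let $\Lambda$ be an aperiodic single-vertex (row-finite, source-free) $k$-graph. Then the action $\phi$ of $\Lambda_{\mathrm{ht}}$ on $\Lambda^\infty$ has Hausdorff germs. So its stabilizer URS is given by $$\mathcal{S}_{\Lambda_{\mathrm{ht}}}(\Lambda^\infty)=\{(\Lambda_{\mathrm{ht}})_x^0:\ x\in\Lambda^\infty\}.$$
   Context: **$k$-graphs.** $\mathbb{N}$ includes $0$ and $k\ge 1$. A $k$-graph is a countable small category $\Lambda$ with a functor $d:\Lambda\to\mathbb{N}^k$ such that whenever $d(\mu)=n+m$ there are unique $\alpha,\beta\in\Lambda$ with $\mu=\alpha\beta$, $d(\alpha)=n$, $d(\beta)=m$, $s(\alpha)=r(\beta)$ (products $\mu\nu$ are defined when $s(\mu)=r(\nu)$). $\Lambda^n:=d^{-1}(n)$; $\Lambda^0$ is the set of vertices; $v\Lambda^n:=\{\mu\in\Lambda^n: r(\mu)=v\}$. $\Lambda$ is row-finite if all $|v\Lambda^n|<\infty$, source-free if all $v\Lambda^n\neq\varnothing$, and single-vertex if $|\Lambda^0|=1$. **Infinite paths.** $\Omega_k:=\{(p,q)\in\mathbb{N}^k\times\mathbb{N}^k: p\le q\}$ is a $k$-graph with $(p,q)(q,m)=(p,m)$, $r(p,q)=(p,p)$, $s(p,q)=(q,q)$, $d(p,q)=q-p$. $\Lambda^\infty$ is the set of degree-preserving functors $x:\Omega_k\to\Lambda$; $v\Lambda^\infty:=\{x\in\Lambda^\infty:x(0,0)=v\}$. If $s(\mu)=x(0,0)$, $\mu x$ is the infinite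 path obtained by prefixing $\mu$ to $x$. $Z(\mu):=\{\mu x: x\in s(\mu)\Lambda^\infty\}$, and the sets $Z(\mu)$ form a basis of the topology of $\Lambda^\infty$. $\Lambda$ is aperiodic if for each $v\in\Lambda^0$ there is $x\in v\Lambda^\infty$ with $\sigma^m(x)\ne\sigma^n(x)$ for all $m\neq n$ in $\mathbb{N}^k$, where $\sigma^n(x)(p,q)=x(p+n,q+n)$. **The C*-algebra and $\Lambda_{\mathrm{ht}}$.** $\mathcal{O}_\Lambda$ is the universal C*-algebra generated by partial isometries $\{s_\mu\}_{\mu\in\Lambda}$ such that: $\{s_v\}_{v\in\Lambda^0}$ are mutually orthogonal projections; $s_{\mu\nu}=s_\mu s_\nu$ if $s(\mu)=r(\nu)$; $s_\mu^*s_\mu=s_{s(\mu)}$; $s_v=\sum_{\mu\in v\Lambda^n}s_\mu s_\mu^*$ for all $v\in\Lambda^0$, $n\in\mathbb{N}^k$. It is unital since $\Lambda^0$ is finite. $\Lambda_{\mathrm{ht}}$ (the Higman-Thompson like group) is the group (under multiplication) of all unitaries $U\in\mathcal{O}_\Lambda$ which can be written as a finite sum $U=\sum_{i=1}^n s_{\alpha_i}s_{\beta_i}^*$ with $\alpha_i,\beta_i\in\Lambda$, $s(\alpha_i)=s(\beta_i)$. **Action $\phi$.** For such $U$, the sets $Z(\beta_i)$ partition $\Lambda^\infty$, as do the sets $Z(\alpha_i)$. $\phi(U)(\beta_iy)=\alpha_iy$ for $y\in s(\beta_i)\Lambda^\infty$ defines an action of $\Lambda_{\mathrm{ht}}$ on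 $\Lambda^\infty$ by homeomorphisms (induced by the left regular representation on $\ell^2(\Lambda^\infty)$), faithful when $\Lambda$ is aperiodic. **Germs and stabilizer URS.** Let a countable group $G$ act faithfully and minimally by homeomorphisms on a compact space $X$. $G_x$ is the stabilizer of $x$, and $G_x^0\le G_x$ is the subgroup of elements fixing pointwise a neighbourhood of $x$. The action has Hausdorff germs if its groupoid of germs is Hausdorff; equivalently, for all $x\in X$ and $g\in G_x$, either $g\in G_x^0$ or $x$ is not an accumulation point of the interior of the fixed point set of $g$. $\mathrm{Sub}(G)\subseteq\{0,1\}^G$ is the compact space of subgroups of $G$ (product topology), with $G$ acting by conjugation; a URS of $G$ is a nonempty closed minimal $G$-invariant subset of $\mathrm{Sub}(G)$. The stabilizer URS $\mathcal{S}_G(X)$ is the unique URS contained in the closure of $\{G_x:x\in X\}$ in $\mathrm{Sub}(G)$. *)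

(* Defs.v *)
From HB Require Import structures.
From mathcomp Require Import all_boot all_order all_algebra.
From mathcomp Require Import complex generic_quotient ring lra.
From mathcomp Require Import all_classical all_reals all_analysis.

Set Implicit Arguments.
Unset Strict Implicit.
Unset Printing Implicit Defensive.

Import Order.TTheory GRing.Theory Num.Theory.
Import numFieldNormedType.Exports.

Local Open Scope classical_set_scope.
Local Open Scope ring_scope.

Notation degree k := {ffun 'I_k -> nat}.

Definition dle (k : nat) (m n : degree k) : bool := [forall i, (m i <= n i)%N].
Definition dsub (k : nat) (m n : degree k) : degree k :=
  [ffun i => (m i - n i)%N].

(* One-sorted presentation of a small category: an object is identified with
   its identity morphism, so that range and source take values in the
   morphisms.  [comp] is total, but only its values on composable pairs
   ([src mu = rng nu]) are constrained. *)
Record kgraph (k : nat) := KGraph {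
  mor :> countType;
  rng : mor -> mor;
  src : mor -> mor;
  comp : mor -> mor -> mor;
  deg : mor -> degree k;
  rng_rng : forall mu, rng (rng mu) = rng mu;
  src_rng : forall mu, src (rng mu) = rng mu;
  rng_src : forall mu, rng (src mu) = src mu;
  src_src : forall mu, src (src mu) = src mu;
  comp_rng : forall mu, comp (rng mu) mu = mu;
  comp_src : forall mu, comp mu (src mu) = mu;
  rng_comp : forall mu nu, src mu = rng nu -> rng (comp mu nu) = rng mu;
  src_comp : forall mu nu, src mu = rng nu -> src (comp mu nu) = src nu;
  compA : forall la mu nu, src la = rng mu -> src mu = rng nu ->
    comp la (comp mu nu) = comp (comp la mu) nu;
  deg_rng : forall mu, deg (rng mu) = 0;
  deg_comp : forall mu nu, src mu = rng nu ->
    deg (comp mu nu) = deg mu + deg nu;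
  factorization : forall mu n m, deg mu = n + m ->
    exists! ab : mor * mor,
      [/\ mu = comp ab.1 ab.2, deg ab.1 = n, deg ab.2 = m &
          src ab.1 = rng ab.2]
}.

Section KGraphs.
Variables (k : nat) (L : kgraph k).

Definition paths_of_degree (n : degree k) : set L := [set mu | deg mu = n].
Definition vertices : set L := paths_of_degree 0.
Definition paths_from (v : L) (n : degree k) : set L :=
  [set mu | paths_of_degree n mu /\ rng mu = v].

Definition row_finite :=
  forall v n, vertices v -> finite_set (paths_from v n).
Definition source_free :=
  forall v n, vertices v -> paths_from v n !=set0.
Definition single_vertex := exists v, vertices = [set v].

End KGraphs.

Section Omega.
Variable k : nat.

Definition omega := {pq : degree k * degree k | dle pq.1 pq.2}.

Lemma dlexx (m : degree k) : dle m m.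
Proof. exact/forallP. Qed.

Lemma dle_trans (m n p : degree k) : dle m n -> dle n p -> dle m p.
Proof.
by move=> /forallP mn /forallP np; apply/forallP => i; exact: leq_trans (np i).
Qed.

Lemma dle_anti (m n : degree k) : dle m n -> dle n m -> m = n.
Proof.
move=> /forallP mn /forallP nm; apply/ffunP => i.
by apply/eqP; rewrite eqn_leq mn nm.
Qed.

Lemma dle0 (n : degree k) : dle 0 n.
Proof. by apply/forallP => i; rewrite ffunE. Qed.

Lemma dleDr (m n p : degree k) : dle m n -> dle (m + p) (n + p).
Proof. by move=> /forallP mn; apply/forallP => i; rewrite !ffunE leq_add2r. Qed.

Lemma dle_addr (m n : degree k) : dle m (m + n).
Proof. by apply/forallP => i; rewrite !ffunE leq_addr. Qed.

Lemma daddK (m n : degree k) : dsub (m + n) m = n.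
Proof. by apply/ffunP => i; rewrite !ffunE addKn. Qed.

Lemma daddKr (m n : degree k) : dsub (m + n) n = m.
Proof. by apply/ffunP => i; rewrite !ffunE addnK. Qed.

Lemma dsubK (m n : degree k) : dle m n -> m + dsub n m = n.
Proof.
by move=> /forallP mn; apply/ffunP => i; rewrite !ffunE; exact: subnKC (mn i).
Qed.

Definition om (p q : degree k) (pq : dle p q) : omega := exist _ (p, q) pq.

Lemma omE (a b : omega) :
  (val a).1 = (val b).1 -> (val a).2 = (val b).2 -> a = b.
Proof.
move=> e1 e2; apply: val_inj; move: e1 e2.
by case: (val a) => a1 a2; case: (val b) => b1 b2 /= -> ->.
Qed.

Definition om_rng (a : omega) : omega := om (dlexx (val a).1).
Definition om_src (a : omega) : omega := om (dlexx (val a).2).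
Definition om_comp (a b : omega) : omega :=
  insubd a ((val a).1, (val b).2).
Definition om_deg (a : omega) : degree k := dsub (val a).2 (val a).1.

Lemma val_om_comp a b : om_src a = om_rng b ->
  val (om_comp a b) = ((val a).1, (val b).2).
Proof.
move=> [ab _]; rewrite /om_comp val_insubd /=.
by rewrite (dle_trans (valP a)) // ab (valP b).
Qed.

Lemma om_src_eq a b : om_src a = om_rng b <-> (val a).2 = (val b).1.
Proof. by split => [[]//|ab]; apply: omE. Qed.

Fact om_rng_comp a b : om_src a = om_rng b -> om_rng (om_comp a b) = om_rng a.
Proof. by move=> ab; apply: omE; rewrite /= val_om_comp. Qed.

Fact om_src_comp a b : om_src a = om_rng b -> om_src (om_comp a b) = om_src b.
Proof. by move=> ab; apply: omE; rewrite /= val_om_comp. Qed.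

Fact om_comp_rng a : om_comp (om_rng a) a = a.
Proof.
have c : om_src (om_rng a) = om_rng a by apply: omE.
by apply: omE; rewrite val_om_comp.
Qed.

Fact om_comp_src a : om_comp a (om_src a) = a.
Proof.
have c : om_src a = om_rng (om_src a) by apply: omE.
by apply: omE; rewrite val_om_comp.
Qed.

Fact om_compA a b c : om_src a = om_rng b -> om_src b = om_rng c ->
  om_comp a (om_comp b c) = om_comp (om_comp a b) c.
Proof.
move=> ab bc; have abc : om_src a = om_rng (om_comp b c) by rewrite om_rng_comp.
have abc' : om_src (om_comp a b) = om_rng c by rewrite om_src_comp.
by apply: val_inj; rewrite !val_om_comp.
Qed.

Fact om_deg_rng a : om_deg (om_rng a) = 0.
Proof. by apply/ffunP => i; rewrite !ffunE subnn. Qed.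

Fact om_deg_comp a b : om_src a = om_rng b ->
  om_deg (om_comp a b) = om_deg a + om_deg b.
Proof.
move=> ab; rewrite /om_deg val_om_comp //=; have /om_src_eq e := ab.
have /forallP pa := valP a; have /forallP pb := valP b.
apply/ffunP => i; rewrite !ffunE; move: (pa i) (pb i); rewrite -e /= => ha hb.
by rewrite [RHS]addnC addnBA // subnK.
Qed.

Fact om_factorization a (n m : degree k) : om_deg a = n + m ->
  exists! ab : omega * omega,
    [/\ a = om_comp ab.1 ab.2, om_deg ab.1 = n, om_deg ab.2 = m &
        om_src ab.1 = om_rng ab.2].
Proof.
case: a => -[p q] pq; rewrite /om_deg /= => anm.
have qE : q = p + n + m by rewrite -addrA -anm dsubK.
subst q; clear anm.
exists (om (dle_addr p n), om (dle_addr (p + n) m)); split => /=.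
  have c : om_src (om (dle_addr p n)) = om_rng (om (dle_addr (p + n) m)).
    exact/om_src_eq.
  split => //; rewrite /om_deg /= ?daddK //.
  by apply: val_inj; rewrite val_om_comp.
move=> [[[a1 a2] ha] [[b1 b2] hb]] /= [/(congr1 val) + + + c].
move: (c) => /om_src_eq /=; rewrite val_om_comp //= => ab [ea eb] an _.
rewrite /om_deg /= in an; congr pair; apply: omE => //=.
  by rewrite -an ea dsubK.
by rewrite -ab -an ea dsubK.
Qed.

Definition Omega : kgraph k := @KGraph k omega om_rng om_src om_comp om_deg
  (fun a => erefl) (fun a => erefl) (fun a => erefl) (fun a => erefl)
  om_comp_rng om_comp_src om_rng_comp om_src_comp om_compA
  om_deg_rng om_deg_comp om_factorization.

End Omega.

Record functor (k : nat) (L M : kgraph k) := Functor {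
  fct :> L -> M;
  fct_rng : forall mu, fct (rng mu) = rng (fct mu);
  fct_src : forall mu, fct (src mu) = src (fct mu);
  fct_comp : forall mu nu, src mu = rng nu ->
    fct (comp mu nu) = comp (fct mu) (fct nu);
  fct_deg : forall mu, deg (fct mu) = deg mu
}.

Lemma functor_ext k (L M : kgraph k) (x y : functor L M) : x =1 y -> x = y.
Proof.
case: x => x x1 x2 x3 x4; case: y => y y1 y2 y3 y4 /= /funext e.
by subst y; congr Functor; exact: Prop_irrelevance.
Qed.

Definition infpath (k : nat) (L : kgraph k) := functor (Omega k) L.

HB.instance Definition _ (k : nat) (L : kgraph k) :=
  gen_eqMixin (infpath L).
HB.instance Definition _ (k : nat) (L : kgraph k) :=
  gen_choiceMixin (infpath L).

Section InfinitePaths.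
Variables (k : nat) (L : kgraph k).
Implicit Types (x y : infpath L) (mu v : L) (n : degree k).

Definition origin x : L := x (om (dlexx 0)).

Definition initial_segment x n : L := x (om (dle0 n)).

Definition om_shift n (a : Omega k) : Omega k :=
  om (dleDr n (valP (a : omega k))).

Fact shift_rng x n (a : Omega k) :
  x (om_shift n (rng a)) = rng (x (om_shift n a)).
Proof. by rewrite -fct_rng; congr (x _); apply: omE. Qed.

Fact shift_src x n (a : Omega k) :
  x (om_shift n (src a)) = src (x (om_shift n a)).
Proof. by rewrite -fct_src; congr (x _); apply: omE. Qed.

Fact shift_comp x n (a b : Omega k) : src a = rng b ->
  x (om_shift n (comp a b)) = comp (x (om_shift n a)) (x (om_shift n b)).
Proof.
move=> ab; have ab' : src (om_shift n a) = rng (om_shift n b).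
  by move/om_src_eq: ab => ab; apply/om_src_eq; rewrite /= ab.
by rewrite -fct_comp //; congr (x _); apply: omE; rewrite /= !val_om_comp.
Qed.

Fact shift_deg x n (a : Omega k) : deg (x (om_shift n a)) = deg a.
Proof.
rewrite fct_deg; apply/ffunP => i.
by rewrite [LHS]ffunE [RHS]ffunE !ffunE /= subnDr.
Qed.

Definition shift n x : infpath L :=
  @Functor k (Omega k) L (fun a => x (om_shift n a))
    (shift_rng x n) (shift_src x n) (shift_comp x n) (shift_deg x n).

Definition aperiodic :=
  forall v : L, vertices v -> exists x, origin x = v /\
    forall m n : degree k, m <> n -> shift m x <> shift n x.

(* [prefix mu x] is the infinite path [mu x], that is, the unique path with
   initial segment [mu] whose shift by [deg mu] is [x]; it exists as soon as
   [src mu = origin x] (lemma [prefixP] below). *)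
Definition prefix mu x : infpath L :=
  xget x [set y | initial_segment y (deg mu) = mu /\ shift (deg mu) y = x].

Definition cylinder mu : set (infpath L) :=
  [set prefix mu x | x in [set x | origin x = src mu]].

End InfinitePaths.

HB.instance Definition _ (k : nat) (L : kgraph k) :=
  isSubBaseTopological.Build (infpath L) (range (@cylinder k L)) id.

Section Prefix.
Variables (k : nat) (L : kgraph k).
Implicit Types (x y : infpath L) (a b c mu nu : L) (n p q : degree k).
Local Notation Om h := (om h : Omega k).

Lemma deg_src mu : deg (src mu) = 0.
Proof. by rewrite -rng_src deg_rng. Qed.

Lemma factor_uniq a b c mu : comp a b = comp c mu -> deg a = deg c ->
  src a = rng b -> src c = rng mu -> a = c /\ b = mu.
Proof.
move=> e dac sab scm.
have [ab [_ u]] := factorization (deg_comp sab).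
have e1 := u (a, b) (And4 erefl erefl erefl sab).
have db : deg mu = deg b.
  move: (deg_comp scm); rewrite -e (deg_comp sab) dac => /ffunP h.
  by apply/ffunP => i; have := h i; rewrite !ffunE => /addnI.
have e2 := u (c, mu) (And4 e (esym dac) db scm).
by move: e1; rewrite e2 => -[-> ->].
Qed.

Lemma deg0_rng mu : deg mu = 0 -> rng mu = mu.
Proof.
move=> mu0; have e : comp (rng mu) mu = comp mu (src mu).
  by rewrite comp_rng comp_src.
by have [] := factor_uniq e _ _ _; rewrite ?deg_rng ?src_rng ?rng_src.
Qed.

Lemma factor_ex mu n : dle n (deg mu) -> exists a b,
  [/\ mu = comp a b, deg a = n, deg b = dsub (deg mu) n & src a = rng b].
Proof.
move=> /dsubK /esym /factorization [[a b] [[]]] *.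
by exists a, b.
Qed.

Definition is_segment mu p q b := exists a c,
  [/\ mu = comp a (comp b c), src a = rng b, src b = rng c, deg a = p &
      deg b = dsub q p].

Lemma segment_ex mu p q : dle p q -> dle q (deg mu) ->
  exists b, is_segment mu p q b.
Proof.
move=> pq qm; have [d [c [-> dd dc sdc]]] := factor_ex qm.
have pd : dle p (deg d) by rewrite dd.
have [a [b [de da db sab]]] := factor_ex pd; subst d.
have sbc : src b = rng c by rewrite -sdc src_comp.
by exists b, a, c; rewrite compA // db dd.
Qed.

Lemma segment_uniq mu p q b c :
  is_segment mu p q b -> is_segment mu p q c -> b = c.
Proof.
move=> [a [d [-> sab sbd da db]]] [a' [d' [e sac scd da' dc]]].
have [_ e2] := factor_uniq e (etrans da (esym da'))
  (etrans sab (esym (rng_comp sbd))) (etrans sac (esym (rng_comp scd))).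
by have [] := factor_uniq e2 (etrans db (esym dc)) sbd scd.
Qed.

Lemma segment_comp mu nu p q b : src mu = rng nu ->
  is_segment mu p q b -> is_segment (comp mu nu) p q b.
Proof.
move=> smn [a [c [me sab sbc da db]]]; subst mu.
have sa : src a = rng (comp b c) by rewrite rng_comp.
have sc : src c = rng nu by rewrite -smn !src_comp.
exists a, (comp c nu); rewrite -!compA ?rng_comp ?src_comp //.
Qed.

Lemma segment_functor x n p q : dle p q -> dle q n ->
  forall pq : dle p q, is_segment (initial_segment x n) p q (x (om pq)).
Proof.
move=> _ qn pq; exists (initial_segment x p), (x (om qn)).
have s1 : src (Om pq) = rng (Om qn) by exact/om_src_eq.
have s2 : src (Om (dle0 p)) = rng (comp (Om pq) (Om qn)).
  by rewrite rng_comp //; exact/om_src_eq.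
have s3 : src (Om (dle0 p)) = rng (Om pq) by exact/om_src_eq.
split.
- rewrite /initial_segment -!fct_comp //; congr (x _).
  by apply: omE; rewrite val_om_comp // val_om_comp.
- by rewrite -fct_src -fct_rng s3.
- by rewrite -fct_src -fct_rng s1.
- by rewrite fct_deg; apply/ffunP => i; rewrite !ffunE subn0.
- by rewrite fct_deg.
Qed.

Section Construction.
Variables (mu : L) (x : infpath L).
Hypothesis smx : src mu = origin x.

Let big n := comp mu (initial_segment x n).

Let origin_rng n : rng (initial_segment x n) = origin x.
Proof. by rewrite -fct_rng; congr (x _); exact: omE. Qed.

Let big_deg n : deg (big n) = deg mu + n.
Proof.
rewrite deg_comp ?origin_rng // fct_deg; congr (_ + _).
by apply/ffunP => i; rewrite !ffunE subn0.
Qed.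

Let bigM m n (mn : dle m n) :
  [/\ big n = comp (big m) (x (om mn)) & src (big m) = rng (x (om mn))].
Proof.
have s1 : src (Om (dle0 m)) = rng (Om mn) by exact/om_src_eq.
have s2 : src (initial_segment x m) = rng (x (om mn)).
  by rewrite -fct_src -fct_rng s1.
split; last by rewrite src_comp // origin_rng.
rewrite -compA ?origin_rng // -fct_comp //; congr (comp _ (x _)).
by apply: omE; rewrite val_om_comp.
Qed.

Let dle_big q n : dle q n -> dle q (deg (big n)).
Proof.
by move=> qn; rewrite big_deg addrC; apply: dle_trans qn (dle_addr _ _).
Qed.

Let seg (a : Omega k) : L :=
  xget mu (is_segment (big (val (a : omega k)).2)
                      (val (a : omega k)).1 (val (a : omega k)).2).

Let segP (a : Omega k) : is_segment (big (val (a : omega k)).2)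
                      (val (a : omega k)).1 (val (a : omega k)).2 (seg a).
Proof.
have [b hb] := segment_ex (valP (a : omega k)) (dle_big (dlexx _)).
exact: (xgetPex mu (ex_intro _ b hb)).
Qed.

Let segE (a : Omega k) n b : dle (val (a : omega k)).2 n ->
  is_segment (big n) (val (a : omega k)).1 (val (a : omega k)).2 b -> seg a = b.
Proof.
move=> an; have [-> s] := bigM an.
by apply: segment_uniq; exact: segment_comp (segP a).
Qed.

Let seg_rng (a : Omega k) : seg (rng a) = rng (seg a).
Proof.
have [c [d [e s1 s2 d1 d2]]] := segP a.
apply: (@segE (rng a) _ _ (valP (a : omega k))).
exists c, (comp (seg a) d).
have e0 : comp (rng (seg a)) (comp (seg a) d) = comp (seg a) d.
  by rewrite -{1}(rng_comp s2) comp_rng.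
rewrite e0 src_rng rng_rng rng_comp //; split => //.
by rewrite deg_rng; apply/ffunP => i; rewrite !ffunE subnn.
Qed.

Let seg_src (a : Omega k) : seg (src a) = src (seg a).
Proof.
have [c [d [e s1 s2 d1 d2]]] := segP a.
apply: (@segE (src a) _ _ (dlexx _)).
exists (comp c (seg a)), d.
have e0 : comp (src (seg a)) d = d by rewrite s2 comp_rng.
rewrite e0 src_src rng_src src_comp // -compA //; split => //.
  by rewrite deg_comp // d1 d2 dsubK // (valP (a : omega k)).
by rewrite deg_src; apply/ffunP => i; rewrite !ffunE subnn.
Qed.

Let seg_deg (a : Omega k) : deg (seg a) = deg a.
Proof. by have [c [d [_ _ _ _ ->]]] := segP a. Qed.

Let seg_comp (a b : Omega k) : src a = rng b ->
  seg (comp a b) = comp (seg a) (seg b).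
Proof.
move=> ab; have abv := (om_src_eq a b).1 ab.
have vab : val (comp a b : omega k) = ((val (a : omega k)).1, (val (b : omega k)).2).
  exact: val_om_comp.
apply: (@segE _ (val (b : omega k)).2); rewrite ?vab ?dlexx //.
have ab2 : dle (val (a : omega k)).2 (val (b : omega k)).2.
  by rewrite abv (valP (b : omega k)).
have [e s] := bigM ab2.
have := segment_comp s (segP a); rewrite -e => -[c [d [e1 s1 s2 d1 d2]]].
have [c' [d' [e1' s1' s2' d1' d2']]] := segP b.
have ds : deg (comp c (seg a)) = deg c'.
  by rewrite deg_comp // d1 d2 d1' dsubK // (valP (a : omega k)).
have [ec ed] : comp c (seg a) = c' /\ d = comp (seg b) d'.
  by apply: factor_uniq; rewrite ?src_comp ?rng_comp // -compA // -e1 -e1'.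
have sab : src (seg a) = rng (seg b).
  by rewrite s2 ed rng_comp.
exists c, d'; split => //=.
- by rewrite e1 ed -[in RHS]compA // rng_comp.
- by rewrite rng_comp.
- by rewrite src_comp.
- rewrite deg_comp // d2 d2' -abv; apply/ffunP => i; rewrite !ffunE.
  have /forallP/(_ i) := valP (a : omega k); have /forallP/(_ i) := ab2.
  by move=> h1 h2; rewrite [LHS]addnC addnBA // subnK.
Qed.

Let path : infpath L := Functor seg_rng seg_src seg_comp seg_deg.

Lemma prefix_exists : exists y : infpath L,
  initial_segment y (deg mu) = mu /\ shift (deg mu) y = x.
Proof.
exists path; split.
  apply: (@segE _ (deg mu)); rewrite /= ?dlexx //.
  exists (rng mu), (initial_segment x (deg mu)).
  rewrite src_rng deg_rng origin_rng; split=> //.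
    by rewrite -{1}(@rng_comp _ _ mu (initial_segment x (deg mu)))
               ?origin_rng // comp_rng.
  by apply/ffunP => i; rewrite !ffunE subn0.
apply: functor_ext => -[[p q] pq].
have qq : dle q (q + deg mu) by exact: dle_addr.
apply: (@segE _ (q + deg mu)); first exact: dlexx.
have [a [c [e s1 s2 d1 d2]]] := segment_functor x pq qq pq.
have sa : src mu = rng a by rewrite smx -(origin_rng (q + deg mu)) e !rng_comp.
exists (comp mu a), c; split => //=.
- by rewrite /big e compA // rng_comp.
- by rewrite src_comp.
- by rewrite deg_comp // d1 addrC.
- by rewrite d2; apply/ffunP => i; rewrite !ffunE subnDr.
Qed.

End Construction.

Lemma initial_segmentD y m n : initial_segment y (m + n) =
  comp (initial_segment y m) (initial_segment (shift m y) n).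
Proof.
have c : src (Om (dle0 m)) = rng (om_shift m (om (dle0 n))).
  by apply/om_src_eq; rewrite /= add0r.
rewrite /initial_segment /= -fct_comp //; congr (y _); apply: omE.
  by rewrite val_om_comp.
by rewrite val_om_comp //= addrC.
Qed.

Lemma infpath_eq y z : (forall n, exists m, dle n m /\
  initial_segment y m = initial_segment z m) -> y = z.
Proof.
move=> yz; apply: functor_ext => -[[p q] pq]; have [m [qm e]] := yz q.
have := segment_functor y pq qm pq; rewrite e => /segment_uniq.
by apply; exact: segment_functor.
Qed.

Lemma prefix_unique mu x y z :
  initial_segment y (deg mu) = mu /\ shift (deg mu) y = x ->
  initial_segment z (deg mu) = mu /\ shift (deg mu) z = x -> y = z.
Proof.
move=> [y1 y2] [z1 z2]; apply: infpath_eq => n; exists (deg mu + n).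
by rewrite !initial_segmentD y1 y2 z1 z2 addrC dle_addr.
Qed.

Lemma prefixP mu x : src mu = origin x ->
  initial_segment (prefix mu x) (deg mu) = mu /\
  shift (deg mu) (prefix mu x) = x.
Proof. by move=> /prefix_exists; exact: (xgetPex x). Qed.

Lemma prefixE mu x y : initial_segment y (deg mu) = mu ->
  shift (deg mu) y = x -> prefix mu x = y.
Proof.
move=> y1 y2; apply: (@prefix_unique mu x); last by split.
have h : exists y, initial_segment y (deg mu) = mu /\ shift (deg mu) y = x.
  by exists y.
exact: (xgetPex x h).
Qed.

End Prefix.

(* A complex Banach space with an associative, not necessarily unital,
   product and an involution satisfying the C*-identity. *)
HB.mixin Record isCStarAlgebra (R : realType) A
    of CompleteNormedModule R[i] A := {
  cmul : A -> A -> A;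
  star : A -> A;
  cmulA : associative cmul;
  cmulDl : left_distributive cmul +%R;
  cmulDr : right_distributive cmul +%R;
  cmulZl : forall (c : R[i]) a b, cmul (c *: a) b = c *: cmul a b;
  cmulZr : forall (c : R[i]) a b, cmul a (c *: b) = c *: cmul a b;
  starD : forall a b, star (a + b) = star a + star b;
  starZ : forall (c : R[i]) a, star (c *: a) = (c^*)%R *: star a;
  starM : forall a b, star (cmul a b) = cmul (star b) (star a);
  starK : involutive star;
  cnormM : forall a b, `|cmul a b| <= `|a| * `|b|;
  cnorm_star : forall a, `|cmul (star a) a| = `|a| ^+ 2
}.

#[short(type="cstarAlgType")]
HB.structure Definition CStarAlgebra (R : realType) :=
  {A of isCStarAlgebra R A & CompleteNormedModule R[i] A}.

Notation "a ** b" := (cmul a b) (at level 40, left associativity) : ring_scope.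

Section CStarDefs.
Variables (R : realType) (A B : cstarAlgType R).

Definition is_unit (e : A) := forall a : A, e ** a = a /\ a ** e = a.

Definition unitary (u : A) := is_unit (star u ** u) /\ is_unit (u ** star u).

Definition projection (p : A) := p ** p = p /\ star p = p.

Definition partial_isometry (a : A) := a ** star a ** a = a.

Definition sub_cstar_algebra (S : set A) :=
  [/\ closed S,
      (forall (c : R[i]) a b, S a -> S b -> S (c *: a + b)),
      (forall a b, S a -> S b -> S (a ** b)) &
      (forall a, S a -> S (star a))].

Definition star_morphism (f : A -> B) :=
  [/\ (forall (c : R[i]) a b, f (c *: a + b) = c *: f a + f b),
      (forall a b, f (a ** b) = f a ** f b) &
      (forall a, f (star a) = star (f a))].

End CStarDefs.

Record ck_family (R : realType) (k : nat) (L : kgraph k)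
    (A : cstarAlgType R) (t : L -> A) : Prop := CKFamily {
  ck_pisom : forall mu, partial_isometry (t mu);
  ck_proj : forall v, vertices v -> projection (t v);
  ck_orth : forall v w, vertices v -> vertices w -> v <> w -> t v ** t w = 0;
  ck_comp : forall mu nu, src mu = rng nu -> t (comp mu nu) = t mu ** t nu;
  ck_src : forall mu, star (t mu) ** t mu = t (src mu);
  (* for a row-finite k-graph, a sum over a finite set *)
  ck_sum : forall v n, vertices v ->
    t v = \sum_(mu \in paths_from v n) t mu ** star (t mu)
}.

(* A model of the universal C*-algebra generated by a family satisfying the
   relations [ck_family]. *)
Record graph_algebra (R : realType) (k : nat) (L : kgraph k) := GraphAlgebra {
  ga_alg :> cstarAlgType R;
  gen : L -> ga_alg;
  gen_ck : ck_family gen;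
  gen_generates : forall S : set ga_alg,
    sub_cstar_algebra S -> (forall mu, S (gen mu)) -> S = setT;
  gen_universal : forall (B : cstarAlgType R) (t : L -> B), ck_family t ->
    exists f : ga_alg -> B, star_morphism f /\ forall mu, f (gen mu) = t mu
}.

Section CStarTheory.
Variables (R : realType) (A : cstarAlgType R).
Implicit Types (a b e p w : A) (c d f : R[i]).

Lemma cmul0l a : 0 ** a = 0.
Proof. by apply: (addrI (0 ** a)); rewrite -cmulDl !addr0. Qed.

Lemma cmul0r a : a ** 0 = 0.
Proof. by apply: (addrI (a ** 0)); rewrite -cmulDr !addr0. Qed.

Lemma cmulNl a b : (- a) ** b = - (a ** b).
Proof. by rewrite -scaleN1r cmulZl scaleN1r. Qed.

Lemma cmulNr a b : a ** (- b) = - (a ** b).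
Proof. by rewrite -[- b]scaleN1r cmulZr scaleN1r. Qed.

Lemma star0 : star (0 : A) = 0.
Proof. by apply: (addrI (star (0 : A))); rewrite -starD !addr0. Qed.

Lemma starN a : star (- a) = - star a.
Proof. by rewrite -scaleN1r starZ rmorphN1 scaleN1r. Qed.

Lemma cmul_suml (I : Type) (r : seq I) (F : I -> A) b :
  (\sum_(i <- r) F i) ** b = \sum_(i <- r) F i ** b.
Proof.
elim: r => [|i r IH]; first by rewrite !big_nil cmul0l.
by rewrite !big_cons cmulDl IH.
Qed.

Lemma cmul_sumr (I : Type) (r : seq I) (F : I -> A) b :
  b ** (\sum_(i <- r) F i) = \sum_(i <- r) b ** F i.
Proof.
elim: r => [|i r IH]; first by rewrite !big_nil cmul0r.
by rewrite !big_cons cmulDr IH.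
Qed.

Lemma star_sum (I : Type) (r : seq I) (F : I -> A) :
  star (\sum_(i <- r) F i) = \sum_(i <- r) star (F i).
Proof.
elim: r => [|i r IH]; first by rewrite !big_nil star0.
by rewrite !big_cons starD IH.
Qed.

Lemma star_mul_eq0 a : star a ** a = 0 -> a = 0.
Proof.
move=> aa; apply/normr0_eq0/eqP; move: (cnorm_star a).
by rewrite aa normr0 => /esym/eqP; rewrite expf_eq0.
Qed.

Lemma projection_norm p : projection p -> `|p| <= 1.
Proof.
move=> [pp sp]; have := cnorm_star p; rewrite sp pp expr2 => e.
have [->|p0] := eqVneq `|p| 0; first exact: ler01.
by rewrite -(mulfI p0 (etrans (mulr1 _) e)).
Qed.

Lemma star_isom_le c a : 0 <= c -> `|star a ** a| <= c ^+ 2 -> `|a| <= c.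
Proof.
by move=> c0; rewrite cnorm_star ler_pXn2r // nnegrE.
Qed.

Section Boost.
Variables (e w : A).
Hypotheses (ep : projection e) (ew : e ** w = w) (we : w ** e = w)
  (sw : star w = w).

Let Q c1 c2 c3 c4 : A :=
  c1 *: e + c2 *: w + c3 *: (w ** w) + c4 *: (w ** w ** w).

Let QD c1 c2 c3 c4 d1 d2 d3 d4 : Q c1 c2 c3 c4 + Q d1 d2 d3 d4 =
  Q (c1 + d1) (c2 + d2) (c3 + d3) (c4 + d4).
Proof.
rewrite /Q !scalerDl [LHS]addrACA; congr (_ + _).
by rewrite [LHS]addrACA; congr (_ + _); rewrite [LHS]addrACA.
Qed.

Let QZ c c1 c2 c3 c4 : c *: Q c1 c2 c3 c4 =
  Q (c * c1) (c * c2) (c * c3) (c * c4).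
Proof. by rewrite /Q !scalerDr !scalerA. Qed.

Let QM c1 c2 c3 d1 d2 : Q c1 c2 c3 0 ** Q d1 d2 0 0 =
  Q (c1 * d1) (c1 * d2 + c2 * d1) (c2 * d2 + c3 * d1) (c3 * d2).
Proof.
have [ee _] := ep.
rewrite /Q !scale0r !addr0 !cmulDl !cmulDr !cmulZl !cmulZr ee ew we.
rewrite -[w ** w ** e]cmulA we !scalerA !scalerDl !addrA.
by congr (_ + _ + _); rewrite -!addrA.
Qed.

Let Qstar c1 c2 : star (Q c1 c2 0 0) = Q (c1^*) (c2^*) 0 0.
Proof.
have [_ es] := ep.
by rewrite /Q !scale0r !addr0 starD !starZ es sw.
Qed.

Let cM a b c d : `|a| <= c -> `|b| <= d -> `|a ** b| <= c * d.
Proof.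
by move=> ac bd; apply: le_trans (cnormM a b) _; apply: ler_pM.
Qed.

Let cD a b c d : `|a| <= c -> `|b| <= d -> `|a + b| <= c + d.
Proof.
by move=> ac bd; apply: le_trans (ler_normD a b) _; apply: lerD.
Qed.

Let cZ c d a : 0 <= c -> `|a| <= d -> `|c *: a| <= c * d.
Proof. by move=> c0 ad; rewrite normrZ ger0_norm // ler_wpM2l. Qed.

Let Qeq c1 c2 c3 c4 d1 d2 d3 d4 : c1 = d1 -> c2 = d2 -> c3 = d3 -> c4 = d4 ->
  Q c1 c2 c3 c4 = Q d1 d2 d3 d4.
Proof. by move=> -> -> -> ->. Qed.

Lemma boost : `|e + w| <= 1 -> `|e - w| <= 1 -> `|e + (18 / 13) *: w| <= 1.
Proof.
move=> h1 h2.
have q0 : `|Q 1 0 0 0| <= 1.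
  by rewrite /Q !scale0r !addr0 scale1r; exact: projection_norm.
have q1 : `|Q 1 1 0 0| <= 1 by rewrite /Q !scale0r !addr0 !scale1r.
have q2 : `|Q 1 (-1) 0 0| <= 1.
  by rewrite /Q !scale0r !addr0 scale1r scaleN1r.
have s1 : `|Q 2 0 6 0| <= 1 * 1 * 1 + 1 * 1 * 1.
  have -> : Q 2 0 6 0 = Q 1 1 0 0 ** Q 1 1 0 0 ** Q 1 1 0 0 +
      Q 1 (-1) 0 0 ** Q 1 (-1) 0 0 ** Q 1 (-1) 0 0.
    rewrite !QM !mul0r !QM QD.
    by apply: Qeq; ring.
  by apply: cD; do 2?apply: cM.
have s2 : `|Q 4 0 9 0| <= (3 / 2) * (1 * 1 * 1 + 1 * 1 * 1) + 1.
  have -> : Q 4 0 9 0 = (3 / 2) *: Q 2 0 6 0 + Q 1 0 0 0.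
    by rewrite QZ QD; apply: Qeq; field.
  apply: cD => //; apply: cZ => //.
have i2 : 'i * 'i = -1 :> R[i] by rewrite -expr2 sqrCi.
have c3 : (3 : R[i])^* = 3 by exact: conjC_nat.
have c2 : (2 : R[i])^* = 2 by exact: conjC_nat.
have s3 : `|Q 2 (3 * 'i) 0 0| <= 2.
  apply: star_isom_le => //; rewrite Qstar rmorphM /= c2 c3 conjCi QM.
  rewrite (_ : Q _ _ _ _ = Q 4 0 9 0).
    by apply: le_trans s2 _; rewrite le_eqVlt; apply/orP; left; apply/eqP; field.
  by apply: Qeq; rewrite ?mulr0 ?mul0r ?addr0; try ring; rewrite mulrN mulNr mulrACA i2; ring.
have s3' : `|Q 2 (- (3 * 'i)) 0 0| <= 2.
  apply: star_isom_le => //; rewrite Qstar rmorphN rmorphM /= c2 c3 conjCi QM.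
  rewrite (_ : Q _ _ _ _ = Q 4 0 9 0).
    by apply: le_trans s2 _; rewrite le_eqVlt; apply/orP; left; apply/eqP; field.
  by apply: Qeq; rewrite ?mulr0 ?mul0r ?addr0; try ring; rewrite mulrNN mulrN mulNr mulrACA i2; ring.
have s4 : `|Q 8 0 (-18) 0| <= 2 * 2 + 2 * 2.
  have -> : Q 8 0 (-18) 0 = Q 2 (3 * 'i) 0 0 ** Q 2 (3 * 'i) 0 0 +
      Q 2 (- (3 * 'i)) 0 0 ** Q 2 (- (3 * 'i)) 0 0.
    rewrite !QM QD mulrNN mulrACA i2.
    by apply: Qeq; ring.
  by apply: cD; apply: cM.
have s5 : `|Q 13 18 0 0| <= 9 * (1 * 1) + (1 / 2) * (2 * 2 + 2 * 2).
  have -> : Q 13 18 0 0 = 9 *: (Q 1 1 0 0 ** Q 1 1 0 0) +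
      (1 / 2) *: Q 8 0 (-18) 0.
    by rewrite QM !QZ QD; apply: Qeq; field.
  by apply: cD; apply: cZ => //; apply: cM.
have -> : e + (18 / 13) *: w = (1 / 13) *: Q 13 18 0 0.
  have u : 1 / 13 * 13 = 1 :> R[i] by field.
  have v : 1 / 13 * 18 = 18 / 13 :> R[i] by field.
  by rewrite QZ u v /Q !mulr0 !scale0r !addr0 scale1r.
apply: le_trans (cZ _ s5) _ => //.
by rewrite le_eqVlt; apply/orP; left; apply/eqP; field.
Qed.

End Boost.

Lemma two_sided_contraction e w : projection e -> e ** w = w -> w ** e = w ->
  star w = w -> `|e + w| <= 1 -> `|e - w| <= 1 -> w = 0.
Proof.
move=> ep ew we sw h1 h2.
have h n : `|e + (18 / 13) ^+ n *: w| <= 1 /\ `|e - (18 / 13) ^+ n *: w| <= 1.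
  elim: n => [|n [IH1 IH2]]; first by rewrite expr0 !scale1r.
  have cr : (((18 / 13) ^+ n)^*)%R = (18 / 13) ^+ n :> R[i].
    by apply/conj_Creal/ger0_real; rewrite exprn_ge0.
  rewrite exprS -scalerA; set u := _ ^+ n *: w in IH1 IH2 *.
  have eu : e ** u = u by rewrite /u cmulZr ew.
  have ue : u ** e = u by rewrite /u cmulZl we.
  have su : star u = u by rewrite /u starZ sw cr.
  split; first exact: boost.
  rewrite -scalerN; apply: boost => //; rewrite ?opprK //.
  - by rewrite cmulNr eu.
  - by rewrite cmulNl ue.
  - by rewrite starN su.
have b n : (1 + n%:R * (5 / 13)) * `|w| <= 2.
  apply: (@le_trans _ _ `|(18 / 13) ^+ n *: w|).
    rewrite normrZ ger0_norm ?exprn_ge0 // ler_wpM2r //.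
    elim: n => [|n IH]; first by rewrite mul0r addr0 expr0.
    rewrite exprSr; apply: (@le_trans _ _ ((1 + n%:R * (5 / 13)) * (18 / 13))).
      rewrite -subr_ge0 -natr1.
      rewrite (_ : _ - _ = n%:R * (25 / 169)); last by field.
      by rewrite mulr_ge0.
    by rewrite ler_wpM2r.
  have [h3 h4] := h n; set u := _ *: w in h3 h4 *.
  rewrite -(@ler_pM2l _ 2) // -[X in X * `|_|](@ger0_norm _ 2) // -normrZ.
  rewrite (_ : 2 *: u = (e + u) - (e - u)); last first.
    by rewrite opprB addrC addrA subrK scaler_nat mulr2n.
  apply: le_trans (ler_normB _ _) _; apply: le_trans (lerD h3 h4) _.
  by rewrite -subr_ge0 (_ : _ - _ = 2) //; ring.
apply/normr0_eq0/eqP; apply/negPn/negP => w0.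
have wp : 0 < `|w| by rewrite lt_def w0 normr_ge0.
have wr : (complex.Re `|w|)%:C%C = `|w| by rewrite RRe_real ?normr_real.
have rp : 0 < complex.Re `|w| by move: wp; rewrite -wr ltcR.
pose n := Num.bound (6 / complex.Re `|w|).
have : ((1 + n%:R * (5 / 13)) * complex.Re `|w|)%:C%C <= 2%:C%C.
  rewrite rmorphM rmorphD rmorph1 rmorphM rmorphM fmorphV !rmorph_nat.
  by rewrite [X in _ * X](_ : _ = `|w|); [exact: b|exact: wr].
rewrite lecR.
have := archi_boundP (ltW (divr_gt0 (ltr0n R 6) rp)); rewrite ltr_pdivrMr // -/n.
move: (n%:R : R) rp => N rp; nra.
Qed.

Lemma projection_sum_orthogonal (I : eqType) (r : seq I) (P : I -> A) p :
  uniq r -> projection p -> \sum_(i <- r) P i = p ->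
  (forall i, i \in r -> [/\ projection (P i), p ** P i = P i & P i ** p = P i]) ->
  forall i j, i \in r -> j \in r -> i != j -> P j ** P i = 0.
Proof.
move=> ur [pp sp] sumP hP i j ir jr ij.
have [[ee se] pe ep] := hP _ ir; set e := P i in ee se pe ep *.
pose x l := e ** P l ** e.
have exl l : e ** x l = x l by rewrite /x !cmulA ee.
have xel l : x l ** e = x l by rewrite /x -!cmulA ee.
have e1 : `|e| <= 1 by exact: projection_norm.
have nx l : l \in r -> `|e - x l| <= 1.
  move=> lr; have [[ll sl] pl lp] := hP _ lr.
  have -> : e - x l = e ** (p - P l) ** e.
    by rewrite cmulDr cmulNr cmulDl cmulNl ep ee.
  have h : `|p - P l| <= 1.
    apply: projection_norm; split; last by rewrite starD starN sp sl.
    rewrite cmulDl !cmulDr !cmulNl !cmulNr pp pl lp ll opprK.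
    by rewrite addNr addr0.
  apply: le_trans (cnormM _ _) _; rewrite -[1]mulr1; apply: ler_pM => //.
  by apply: le_trans (cnormM _ _) _; rewrite -[1]mulr1; apply: ler_pM.
pose s := rem j (rem i r).
have us : uniq s by rewrite !rem_uniq.
have sr l : l \in s -> l \in r by move=> /mem_rem/mem_rem.
have pr : perm_eq r (i :: j :: s).
  apply: perm_trans (perm_to_rem ir) _; rewrite perm_cons.
  by apply: perm_to_rem; rewrite mem_rem_uniq // !inE eq_sym ij.
have sumx : x j + \sum_(l <- s) x l = 0.
  have : e ** p ** e = x i + (x j + \sum_(l <- s) x l).
    by rewrite -sumP cmul_sumr cmul_suml (perm_big _ pr) /= !big_cons.
  by rewrite ep ee /x -/e !ee => /esym/(canRL (addKr _)); rewrite addNr.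
have h1 : `|e *+ size s + x j| <= (size s)%:R.
  have -> : e *+ size s + x j = \sum_(l <- s) (e - x l).
    rewrite sumrB big_const_seq count_predT iter_addr_0.
    by congr (_ + _); apply/eqP; rewrite -addr_eq0 sumx.
  apply: le_trans (ler_norm_sum _ _ _) _.
  rewrite big_seq; apply: le_trans (ler_sum _ (fun l ls => nx l (sr l ls))) _.
  by rewrite -big_seq big_const_seq count_predT iter_addr_0.
have N0 : ((size s).+1%:R : R[i]) != 0 by rewrite pnatr_eq0.
have N1 : 0 <= ((size s).+1%:R : R[i])^-1 by rewrite invr_ge0 ler0n.
have resc z : `|e *+ (size s).+1 + z| <= (size s).+1%:R ->
    `|e + ((size s).+1%:R)^-1 *: z| <= 1.
  move=> h; have -> : e + ((size s).+1%:R)^-1 *: z =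
      ((size s).+1%:R)^-1 *: (e *+ (size s).+1 + z).
    by rewrite scalerDr -[e *+ _]scaler_nat scalerA mulVf // scale1r.
  rewrite normrZ ger0_norm //; apply: le_trans (ler_wpM2l N1 h) _.
  by rewrite mulVf.
have x0 : ((size s).+1%:R)^-1 *: x j = 0.
  have sx : star (x j) = x j.
    have [[_ sl] _ _] := hP _ jr.
    by rewrite /x !starM se sl cmulA.
  apply: (@two_sided_contraction e).
  - by split.
  - by rewrite cmulZr exl.
  - by rewrite cmulZl xel.
  - by rewrite starZ sx conj_Creal // ger0_real.
  - apply: resc; rewrite mulrS -addrA -natr1 addrC.
    by apply: le_trans (ler_normD _ _) _; apply: lerD.
  - rewrite -scalerN; apply: resc; rewrite mulrSr -addrA -natr1.
    apply: le_trans (ler_normD _ _) _; apply: lerD (nx _ jr).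
    by rewrite normrMn; exact: ler_wMn2r.
have {}x0 : x j = 0.
  by move/eqP: x0; rewrite scaler_eq0 invr_eq0 (negPf N0) => /eqP.
apply: star_mul_eq0; have [[jj sj] _ _] := hP _ jr.
by rewrite starM sj se !cmulA -[e ** _ ** _]cmulA jj.
Qed.

End CStarTheory.

Section HigmanThompson.
Variables (R : realType) (k : nat) (L : kgraph k) (O : graph_algebra R L).
Implicit Types (l : seq (L * L)) (v mu nu : L) (n : degree k).

Local Notation s := (@gen R k L O).

Definition source_matching l := forall p, p \in l -> src p.1 = src p.2.

Definition ht_sum l : O := \sum_(p <- l) s p.1 ** star (s p.2).

Definition in_ht (U : O) :=
  unitary U /\ exists l, source_matching l /\ U = ht_sum l.

Lemma gen_rng_mul mu : s (rng mu) ** s mu = s mu.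
Proof. by rewrite -(ck_comp (gen_ck O)) ?src_rng // comp_rng. Qed.

Lemma gen_mul_src mu : s mu ** s (src mu) = s mu.
Proof. by rewrite -(ck_comp (gen_ck O)) ?rng_src // comp_src. Qed.

Lemma vertex_rng mu : vertices (rng mu).
Proof. exact: deg_rng. Qed.

Lemma vertex_src mu : vertices (src mu).
Proof. exact: deg_src. Qed.

Lemma star_gen_vertex v : vertices v -> star (s v) = s v.
Proof. by move=> /(ck_proj (gen_ck O)) []. Qed.

Lemma src_vertex v : vertices v -> src v = v.
Proof. by move=> /deg0_rng <-; exact: src_rng. Qed.

Lemma star_gen_mul_rng mu : star (s mu) ** s (rng mu) = star (s mu).
Proof.
by rewrite -(star_gen_vertex (vertex_rng mu)) -starM gen_rng_mul.
Qed.

Lemma src_mul_star_gen mu : s (src mu) ** star (s mu) = star (s mu).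
Proof.
by rewrite -(star_gen_vertex (vertex_src mu)) -starM gen_mul_src.
Qed.

Lemma gen_range_projection mu : projection (s mu ** star (s mu)).
Proof.
split; last by rewrite starM starK.
by rewrite cmulA -[_ ** star _ ** _]cmulA (ck_src (gen_ck O)) gen_mul_src.
Qed.

Lemma vertex_sum v n : vertices v -> exists r : seq L, [/\ uniq r,
  (forall mu, mu \in r -> paths_from v n mu),
  s v = \sum_(mu <- r) s mu ** star (s mu) &
  forall mu, paths_from v n mu -> mu \notin r -> s mu = 0].
Proof.
move=> vv; have := ck_sum (gen_ck O) n vv.
case: finite_supportP => [_|r rP r0 _] sE.
  exists [::]; split=> // mu [_ rmu] _; rewrite -gen_rng_mul rmu sE.
  by rewrite big_nil cmul0l.
exists (finmap.enum_fset r); split=> //; first exact: finmap.fset_uniq.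
move=> mu pmu /(r0 _ pmu) h; rewrite -gen_mul_src -(ck_src (gen_ck O)).
by rewrite cmulA h cmul0l.
Qed.

Lemma gen_orthogonal mu nu : rng mu = rng nu -> deg mu = deg nu -> mu <> nu ->
  star (s mu) ** s nu = 0.
Proof.
move=> rmn dmn /eqP mn.
have [r [ur rP sE r0]] := vertex_sum (deg mu) (vertex_rng mu).
have [mr|/r0 ->//] := boolP (mu \in r); last by rewrite star0 cmul0l.
have [nr|/r0 ->//] := boolP (nu \in r); last by rewrite cmul0r.
have gm : star (s mu) ** (s mu ** star (s mu)) = star (s mu).
  by rewrite cmulA (ck_src (gen_ck O)) src_mul_star_gen.
have gn : s nu ** star (s nu) ** s nu = s nu by exact: ck_pisom (gen_ck O) nu.
rewrite -{1}gm -{1}gn cmulA -[_ ** (s mu ** _) ** _]cmulA.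
rewrite (projection_sum_orthogonal ur _ (esym sE) _ nr mr) ?cmul0r ?cmul0l //.
- exact: ck_proj (gen_ck O) _ (vertex_rng mu).
- move=> la /rP [_ <-]; split; first exact: gen_range_projection.
    by rewrite cmulA gen_rng_mul.
  by rewrite -cmulA star_gen_mul_rng.
- by rewrite eq_sym.
Qed.

Lemma ht_sum_star l : star (ht_sum l) = ht_sum [seq (p.2, p.1) | p <- l].
Proof.
rewrite /ht_sum star_sum big_map; apply: eq_bigr => p _.
by rewrite starM starK.
Qed.

Lemma source_matching_swap l :
  source_matching l -> source_matching [seq (p.2, p.1) | p <- l].
Proof. by move=> sl _ /mapP[p pl ->] /=; rewrite sl. Qed.

Lemma in_ht_star U : in_ht U -> in_ht (star U).
Proof.
move=> [[u1 u2] [l [sl lU]]]; split; first by rewrite /unitary starK.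
exists [seq (p.2, p.1) | p <- l]; rewrite lU ht_sum_star.
by split => //; exact: source_matching_swap.
Qed.

(* Expanding each term by the Cuntz-Krieger relation makes all the first
   components of equal degree. *)
Lemma ht_sum_refine l n : source_matching l ->
  (forall p, p \in l -> dle (deg p.1) n) ->
  exists l', [/\ source_matching l', ht_sum l' = ht_sum l &
    forall p, p \in l' -> deg p.1 = n].
Proof.
elim: l => [|[mu nu] l IH] sl ln; first by exists [::].
have [p pl|p pl|l' [sl' el' dl']] := IH.
- by apply: sl; rewrite inE pl orbT.
- by apply: ln; rewrite inE pl orbT.
have smn : src mu = src nu by apply: (sl (mu, nu)); rewrite inE eqxx.
have dmu : dle (deg mu) n by apply: (ln (mu, nu)); rewrite inE eqxx.
have [r [_ rP rE _]] := vertex_sum (dsub n (deg mu)) (vertex_src mu).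
exists ([seq (comp mu la, comp nu la) | la <- r] ++ l'); split.
- move=> p; rewrite mem_cat => /orP[/mapP[la /rP[_ rla] ->]|/sl' //].
  by rewrite /= !src_comp // -smn.
- rewrite /ht_sum big_cat big_cons big_map /= -/(ht_sum l') -/(ht_sum l) el'.
  congr (_ + _); rewrite -[s mu]gen_mul_src rE cmul_sumr cmul_suml.
  rewrite big_seq [RHS]big_seq; apply: eq_bigr => la /rP[_ rla].
  by rewrite !(ck_comp (gen_ck O)) -?smn // starM !cmulA.
- move=> p; rewrite mem_cat => /orP[/mapP[la /rP[dla rla] ->]|/dl' //].
  by rewrite /= deg_comp // dla dsubK.
Qed.

Lemma degree_bound (l : seq L) : exists n, forall mu, mu \in l -> dle (deg mu) n.
Proof.
elim: l => [|mu l [n hn]]; first by exists 0.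
exists (deg mu + n) => nu; rewrite inE => /orP[/eqP ->|/hn h].
  exact: dle_addr.
by rewrite addrC; apply: dle_trans h (dle_addr _ _).
Qed.

Hypothesis sv : single_vertex L.

Lemma single_vertex_eq v w : vertices v -> vertices w -> v = w.
Proof. by have [u ->] := sv => -> ->. Qed.

Lemma ht_sumM l l' : source_matching l -> source_matching l' ->
  exists l'', source_matching l'' /\ ht_sum l ** ht_sum l' = ht_sum l''.
Proof.
move=> sl sl'.
have [n hn] := degree_bound ([seq p.2 | p <- l] ++ [seq p.1 | p <- l']).
have [p /mapP[q ql ->]|m [sm em dm]] :=
    ht_sum_refine (n := n) (source_matching_swap sl).
  by apply: hn; rewrite mem_cat (map_f (fun p => p.2) ql).
have [p pl'|m' [sm' em' dm']] := ht_sum_refine (n := n) sl'.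
  by apply: hn; rewrite mem_cat (map_f (fun p => p.1) pl') orbT.
have {em} em : ht_sum [seq (p.2, p.1) | p <- m] = ht_sum l.
  rewrite -ht_sum_star em -ht_sum_star starK //.
exists [seq (p.2, q.2) | p <- m, q <- [seq q <- m' | q.1 == p.1]].
split.
  move=> _ /allpairsPdep [p [q [pm + ->]]] /=.
  by rewrite mem_filter => /andP[/eqP pq qm]; rewrite -sm // -pq sm'.
rewrite -em -em' /ht_sum big_map cmul_suml big_allpairs_dep /=.
rewrite big_seq [RHS]big_seq; apply: eq_bigr => p pm.
rewrite cmul_sumr big_filter [RHS]big_mkcond /=.
rewrite big_seq [RHS]big_seq; apply: eq_bigr => q qm.
rewrite cmulA -[_ ** _ ** s q.1]cmulA; case: eqP => [->|/nesym pq].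
  by rewrite (ck_src (gen_ck O)) sm // gen_mul_src.
suff -> : star (s p.1) ** s q.1 = 0 by rewrite cmul0r cmul0l.
apply: gen_orthogonal => //; last by rewrite dm // dm'.
exact: single_vertex_eq (vertex_rng _) (vertex_rng _).
Qed.

Definition the_vertex : L := sval (cid sv).

Lemma the_vertexP : vertices the_vertex.
Proof. by rewrite /the_vertex; case: cid => v /= ->. Qed.

Lemma gen_vertex_unit : is_unit (s the_vertex).
Proof.
set e := s the_vertex; have [ee se] := ck_proj (gen_ck O) the_vertexP.
suff h : [set a : O | e ** a = a /\ a ** e = a] = setT.
  by move=> a; have : [set: O] a by []; rewrite -h.
apply: (gen_generates (g := O)) => [|mu]; last first.
  have sm : src mu = the_vertex.
    exact: single_vertex_eq (vertex_src _) the_vertexP.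
  have rm : rng mu = the_vertex.
    exact: single_vertex_eq (vertex_rng _) the_vertexP.
  by rewrite /= /e; split; [rewrite -rm gen_rng_mul|rewrite -sm gen_mul_src].
have e1 : `|e| <= 1 by exact: projection_norm.
have close (z : O) : (forall eps, 0 < eps -> `|z| <= 2 * eps) -> z = 0.
  move=> h; apply/normr0_eq0/eqP; apply/negPn/negP => z0.
  have zp : 0 < `|z| by rewrite lt_def z0 normr_ge0.
  have := h (`|z| / 4) (divr_gt0 zp (ltr0n _ 4)).
  rewrite (_ : 2 * _ = `|z| * 2^-1); last by field.
  by rewrite ler_pMr // lt_geF // invf_lt1 ?ltr1n // ltr0n.
split => [a ca|c a b [a1 a2] [b1 b2]|a b [a1 a2] [b1 b2]|a [a1 a2]] /=.
- split; apply/eqP; rewrite -subr_eq0; apply/eqP/close => eps eps0.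
  + have [b [[eb be] ab]] := ca _ (nbhsx_ballx a eps eps0).
    rewrite -ball_normE /= in ab.
    have -> : e ** a - a = e ** (a - b) - (a - b).
      by rewrite cmulDr cmulNr eb opprB addrA subrK.
    apply: le_trans (ler_normB _ _) _; rewrite mulr_natl mulr2n.
    apply: lerD; last exact: ltW.
    apply: le_trans (cnormM _ _) _; rewrite -[eps]mul1r.
    by apply: ler_pM => //; exact: ltW.
  + have [b [[eb be] ab]] := ca _ (nbhsx_ballx a eps eps0).
    rewrite -ball_normE /= in ab.
    have -> : a ** e - a = (a - b) ** e - (a - b).
      by rewrite cmulDl cmulNl be opprB addrA subrK.
    apply: le_trans (ler_normB _ _) _; rewrite mulr_natl mulr2n.
    apply: lerD; last exact: ltW.
    apply: le_trans (cnormM _ _) _; rewrite -[eps]mulr1.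
    by apply: ler_pM => //; exact: ltW.
- by rewrite cmulDr cmulDl cmulZr cmulZl a1 a2 b1 b2.
- by rewrite cmulA a1 -cmulA b2.
- by split; rewrite /e -{1}se -starM ?a1 ?a2.
Qed.

Lemma in_ht_one : in_ht (s the_vertex).
Proof.
have [ee se] := ck_proj (gen_ck O) the_vertexP.
split; first by split; rewrite se ee; exact: gen_vertex_unit.
exists [:: (the_vertex, the_vertex)]; split.
  by move=> p; rewrite inE => /eqP ->.
by rewrite /ht_sum big_cons big_nil addr0 se ee.
Qed.

Lemma is_unit_eq (a b : O) : is_unit a -> is_unit b -> a = b.
Proof. by move=> ha hb; rewrite -[LHS](hb a).2 (ha b).1. Qed.

Lemma in_htM U V : in_ht U -> in_ht V -> in_ht (U ** V).
Proof.
move=> [[u1 u2] [l [sl lU]]] [[v1 v2] [l' [sl' lV]]]; split.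
  split; rewrite starM cmulA.
    by rewrite -[star V ** star U ** U]cmulA (u1 _).2.
  by rewrite -[U ** V ** star V]cmulA (v2 _).2.
by rewrite lU lV; exact: ht_sumM.
Qed.

(* The parameter [hsv] is not used in the fields: it provides the vertex whose
   projection is the neutral element of the group structure below. *)
Record ht_type (hsv : single_vertex L) : Type :=
  Ht { ht_val :> O; ht_valP : in_ht ht_val }.

Local Notation ht := (ht_type sv).

Lemma ht_val_inj : injective (@ht_val sv).
Proof.
case=> U hU [V hV] /= UV; subst V; congr Ht; exact: Prop_irrelevance.
Qed.

HB.instance Definition _ := gen_eqMixin ht.
HB.instance Definition _ := gen_choiceMixin ht.

Definition ht_one : ht := Ht sv in_ht_one.
Definition ht_mul (U V : ht) : ht := Ht sv (in_htM (ht_valP U) (ht_valP V)).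
Definition ht_inv (U : ht) : ht := Ht sv (in_ht_star (ht_valP U)).

Fact ht_mulA : associative ht_mul.
Proof. by move=> U V W; apply: ht_val_inj; rewrite /= cmulA. Qed.

Fact ht_mul1g : left_id ht_one ht_mul.
Proof. by move=> U; apply: ht_val_inj; exact: (gen_vertex_unit _).1. Qed.

Fact ht_mulg1 : right_id ht_one ht_mul.
Proof. by move=> U; apply: ht_val_inj; exact: (gen_vertex_unit _).2. Qed.

Fact ht_mulVg : left_inverse ht_one ht_inv ht_mul.
Proof.
move=> U; apply: ht_val_inj; apply: is_unit_eq gen_vertex_unit.
by have [[]] := ht_valP U.
Qed.

Fact ht_mulgV : right_inverse ht_one ht_inv ht_mul.
Proof.
move=> U; apply: ht_val_inj; apply: is_unit_eq gen_vertex_unit.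
by have [[]] := ht_valP U.
Qed.

HB.instance Definition _ :=
  isGroup.Build ht ht_mulA ht_mul1g ht_mulg1 ht_mulVg ht_mulgV.

End HigmanThompson.

Section HigmanThompsonAction.
Variables (R : realType) (k : nat) (L : kgraph k) (O : graph_algebra R L).
Variable sv : single_vertex L.

(* [phi U (beta_i y) = alpha_i y] for every way of writing
   [U = \sum_i s_(alpha_i) s_(beta_i)^*]. *)
Definition ht_canonical_action (phi : ht_type O sv -> infpath L -> infpath L) :=
  forall (U : ht_type O sv) (l : seq (L * L)),
    source_matching l -> ht_val U = ht_sum O l ->
    forall alpha beta, (alpha, beta) \in l ->
    forall y, origin y = src beta -> phi U (prefix beta y) = prefix alpha y.

End HigmanThompsonAction.

Section Germs.
Variables (G : groupType) (X : topologicalType) (act : G -> X -> X).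

Definition stabilizer (x : X) : set G := [set g | act g x = x].

Definition germ_stabilizer (x : X) : set G :=
  [set g | \forall y \near x, act g y = y].

Definition germ_rel (p q : G * X) : bool :=
  `[< p.2 = q.2 /\ \forall y \near p.2, act p.1 y = act q.1 y >].

Fact germ_rel_refl : reflexive germ_rel.
Proof. by move=> p; apply/asboolP; split=> //; exact: nearW. Qed.

Fact germ_rel_sym : symmetric germ_rel.
Proof.
by move=> [g x] [h y]; apply/idP/idP => /asboolP[/= -> gh]; apply/asboolP;
  split=> //=; apply: filterS gh.
Qed.

Fact germ_rel_trans : transitive germ_rel.
Proof.
move=> [h y] [g x] [f z] /asboolP[/= -> gh] /asboolP[/= yz hf].
apply/asboolP; split=> //=.
by apply: filterS2 gh hf => w -> ->.
Qed.

Definition germ_equiv : equiv_rel (G * X)%type :=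
  EquivRel germ_rel germ_rel_refl germ_rel_sym germ_rel_trans.

Definition germs : Type := {eq_quot germ_equiv}%qT.

HB.instance Definition _ := Choice.on germs.

Definition germ (g : G) (x : X) : germs := \pi_({eq_quot germ_equiv})%qT (g, x).

(* The topology of the groupoid of germs: the sets of germs of [g] at the
   points of an open set [U] form a base. *)
HB.instance Definition _ := isSubBaseTopological.Build germs
  [set W | exists g U, open U /\ W = [set germ g x | x in U]] id.

Definition hausdorff_germs := hausdorff_space germs.

End Germs.

Section URS.
Variable G : groupType.
Implicit Types (H : set G) (S T : set {ptws G -> bool}).

Definition indicator H : {ptws G -> bool} := fun g => `[< H g >].

Definition is_subgroup H :=
  [/\ H 1%g, forall g h, H g -> H h -> H (g * h)%g &
      forall g, H g -> H (g^-1)%g].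

(* The space [Sub(G)] of subgroups, a closed subset of [{0,1}^G], so that
   closedness and closures may be taken in [{0,1}^G]. *)
Definition Sub : set {ptws G -> bool} := [set indicator H | H in is_subgroup].

(* [indicator H] is sent to [indicator (g H g^-1)]. *)
Definition conj_subset (g : G) (chi : {ptws G -> bool}) : {ptws G -> bool} :=
  fun h => chi (g^-1 * h * g)%g.

Definition conj_invariant S := forall g chi, S chi -> S (conj_subset g chi).

Definition is_URS S :=
  [/\ S `<=` Sub, S !=set0, closed S, conj_invariant S &
      forall T, T `<=` S -> T !=set0 -> closed T -> conj_invariant T -> T = S].

Definition is_stabilizer_URS (X : topologicalType) (act : G -> X -> X) S :=
  unique (fun S' => is_URS S' /\
    S' `<=` closure (range (fun x => indicator (stabilizer act x)))) S.

End URS.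

(* Main.v *)
From mathcomp Require Import all_boot all_order all_algebra.
From mathcomp Require Import generic_quotient.
From mathcomp Require Import all_classical all_reals all_analysis.
Require Import Defs.

(** The idea is that an element [U] of the group acts near each infinite path
    by rewriting an initial segment [beta] into some [alpha], that is, by
    [beta y |-> alpha y] ([phi_local]).  If two such rules [beta y |-> alpha y]
    and [beta y |-> alpha' y] agree at one path with aperiodic tail [y], then
    [alpha y = alpha' y]; comparing tails forces [deg alpha = deg alpha'], and
    unique factorization then gives [alpha = alpha'] ([prefix_inj]).  As
    aperiodic paths are dense, two elements of the group either agree on a
    whole neighbourhood of a given path, or they have different germs at all
    points of some neighbourhood ([germ_dichotomy]).  This gives at once that
    the groupoid of germs is Hausdorff ([phi_hausdorff_germs]), that for each
    [U] the set of paths at which [U] has a trivial germ is clopen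
    ([germ_stabilizer_closed]), and that the stabilizer and the germ stabilizer
    of an aperiodic path coincide ([aperiodic_free]).

    The stabilizer URS is then found for any minimal action on a compact
    Hausdorff space with the last two properties ([stabilizer_URS_germ]).  The
    map sending [x] to its germ stabilizer is continuous and equivariant, so its
    range is a closed invariant set, and any closed invariant set containing
    the germ stabilizer of one point contains the range.  Every limit of
    stabilizers lies between the germ stabilizer and the stabilizer of some
    point; by minimality, a closed invariant set of such limits has an element
    lying over a given free point [z], where there is nothing strictly in
    between, so it contains the germ stabilizer of [z].  Both minimality of the
    range and uniqueness of the URS follow.

    It remains to see that [phi] is a minimal action.  That the sets
    [Z(beta_i)] cover the path space is an algebraic fact about a unitary
    [\sum_i s_(alpha_i) s_(beta_i)^*], once the generators are known to be
    nonzero ([unitary_cover]).  They are nonzero because [phi] is well defined: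
    in the zero algebra all sums would present the same element ([gen_neq0]).
    Multiplicativity is then the computation of a product of two presentations
    ([ht_sum_pair_comp]), and orbits are dense because exchanging two paths of
    the same degree defines a unitary of the group ([ht_involution]). *)

Set Implicit Arguments.
Unset Strict Implicit.
Unset Printing Implicit Defensive.

Import GRing.Theory.

Local Open Scope classical_set_scope.

(** * Preliminaries from topology *)

Lemma closed_fixpoints (X : topologicalType) (f : X -> X) :
  hausdorff_space X -> continuous f -> closed [set x | f x = x].
Proof.
move=> hX fc x cx; apply: hX => A B fxA xB.
have [y [/= fy [Ay By]]] := cx _ (filterI (fc x A fxA : nbhs x (f @^-1` A)) xB).
by exists y; split=> //; rewrite -fy.
Qed.

(** An ultrafilter decides each of the finitely many fibres of [f], and it
    cannot reject them all. *)
Lemma ultra_finite (T S : choiceType) (F : set_system T) (f : T -> S)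
    (A : set S) :
  UltraFilter F -> finite_set A -> (forall t, A (f t)) ->
  exists s, F (f @^-1` [set s]).
Proof.
move=> FU /finite_seqP[s As] Af.
suff: exists2 a, a \in s & F (f @^-1` [set a]) by case=> a _; exists a.
have : F [set t | f t \in s].
  by apply: filterS filterT => t _; have := Af t; rewrite As.
elim: s {As Af} => [|a s IH] Fs.
  have /filter_ex[t] : F set0 by apply: filterS Fs.
  by [].
have [Fa|Fa] := in_ultra_setVsetC (f @^-1` [set a]) FU.
  by exists a => //; rewrite inE eqxx.
have [|b bs Fb] := IH; last by exists b => //; rewrite inE bs orbT.
apply: filterS2 Fs Fa => t /=; rewrite inE => /orP[/eqP //|//].
Qed.

Lemma continuous_to_ptws (G : Type) (Y : topologicalType)
    (f : Y -> {ptws G -> bool}) :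
  (forall g (p : Y), \forall q \near p, f q g = f p g) -> continuous f.
Proof.
move=> fc y; apply/cvg_sup => g U [V] [[W] oW <-] /= WfN WU.
apply: filterS (fc g y) => y' fy'; apply: WU => /=.
by rewrite fy'.
Qed.

Lemma coordinate_continuous (G : eqType) (g : G) :
  continuous (fun chi : {ptws G -> bool} => chi g).
Proof. exact: (@proj_continuous _ (fun _ : G => bool) g). Qed.

Lemma ptws_bool_compact (G : eqType) : compact [set: {ptws G -> bool}].
Proof.
have := @tychonoff _ (fun _ : G => bool) (fun=> setT) (fun=> bool_compact).
by congr compact; apply/seteqP; split.
Qed.

Lemma ptws_bool_hausdorff (G : eqType) : hausdorff_space {ptws G -> bool}.
Proof.
apply: (@hausdorff_product _ (fun _ : G => bool)) => _.
exact: discrete_hausdorff.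
Qed.

(** * Infinite paths *)

Section Paths.
Variables (k : nat) (L : kgraph k).
Implicit Types (x y z : infpath L) (a b mu nu : L) (m n p : degree k).
Local Open Scope ring_scope.

Lemma shift_shift m n x : shift m (shift n x) = shift (n + m) x.
Proof.
by apply: functor_ext => a; congr (fct x _); apply: omE => /=;
  rewrite -addrA [m + n]addrC.
Qed.

Lemma deg_initial_segment x n : deg (initial_segment x n) = n.
Proof. by rewrite fct_deg; apply/ffunP => i; rewrite !ffunE subn0. Qed.

Lemma rng_initial_segment x n : rng (initial_segment x n) = origin x.
Proof. by rewrite -fct_rng; congr (x _); exact: omE. Qed.

Lemma src_initial_segment x n : src (initial_segment x n) = origin (shift n x).
Proof. by rewrite -fct_src; congr (fct x _); apply: omE; rewrite /= add0r. Qed.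

Lemma initial_segmentD_inj x y m n :
  initial_segment x (m + n) = initial_segment y (m + n) ->
  initial_segment x m = initial_segment y m /\
  initial_segment (shift m x) n = initial_segment (shift m y) n.
Proof.
rewrite !initial_segmentD => e; apply: factor_uniq e _ _ _.
- by rewrite !deg_initial_segment.
- by rewrite rng_initial_segment src_initial_segment.
- by rewrite rng_initial_segment src_initial_segment.
Qed.

Lemma initial_segment_le x y m n : dle m n ->
  initial_segment x n = initial_segment y n ->
  initial_segment x m = initial_segment y m.
Proof. by move=> /dsubK <- /initial_segmentD_inj[]. Qed.

Lemma initial_segment_inj x y :
  (forall n, initial_segment x n = initial_segment y n) -> x = y.
Proof. by move=> h; apply: infpath_eq => n; exists n; rewrite dlexx. Qed.

Lemma prefix_shift x n : prefix (initial_segment x n) (shift n x) = x.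
Proof. by apply: prefixE; rewrite deg_initial_segment. Qed.

Lemma prefix_vertex v x : v = initial_segment x 0 -> prefix v x = x.
Proof.
move=> ->; rewrite -[RHS](prefix_shift x 0); congr prefix.
by apply: functor_ext => a; congr (fct x _); apply: omE; rewrite /= addr0.
Qed.

(** Aperiodicity of a single path, the condition that [aperiodic] asks of some
    path at every vertex. *)
Definition aperiodic_path x := forall m n, m <> n -> shift m x <> shift n x.

Lemma aperiodic_shift n x : aperiodic_path x -> aperiodic_path (shift n x).
Proof.
move=> ax p q pq; rewrite !shift_shift; apply: ax => e; apply: pq.
by rewrite -(daddK n p) e daddK.
Qed.

End Paths.

Section SingleVertexPaths.
Variables (k : nat) (L : kgraph k).
Hypothesis sv : single_vertex L.
Implicit Types (x y z : infpath L) (a b mu nu : L) (m n p : degree k).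
Local Open Scope ring_scope.

Lemma src_eq_rng mu nu : src mu = rng nu.
Proof. exact: (single_vertex_eq sv (vertex_src mu) (vertex_rng nu)). Qed.

Lemma origin_eq_src x mu : origin x = src mu.
Proof. by rewrite -(rng_initial_segment x 0) -(src_eq_rng mu). Qed.

Lemma initial_segment_prefix mu x :
  initial_segment (prefix mu x) (deg mu) = mu.
Proof. by have [] := prefixP (esym (origin_eq_src x mu)). Qed.

Lemma shift_prefix mu x : shift (deg mu) (prefix mu x) = x.
Proof. by have [] := prefixP (esym (origin_eq_src x mu)). Qed.

Lemma initial_segment_prefixD mu x n :
  initial_segment (prefix mu x) (deg mu + n) = comp mu (initial_segment x n).
Proof. by rewrite initial_segmentD initial_segment_prefix shift_prefix. Qed.

Lemma prefix_comp a b x : prefix (comp a b) x = prefix a (prefix b x).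
Proof.
have ab := src_eq_rng a b.
apply: prefixE; rewrite deg_comp //.
  by rewrite initial_segment_prefixD initial_segment_prefix.
by rewrite -shift_shift !shift_prefix.
Qed.

Lemma cylinderE mu : cylinder mu = [set x | initial_segment x (deg mu) = mu].
Proof.
apply/seteqP; split=> [_ [y _ <-]|x xmu] /=.
  exact: initial_segment_prefix.
exists (shift (deg mu) x); first exact: origin_eq_src.
exact: prefixE.
Qed.

(** [a x = b x] forces [x] to repeat itself after [deg a] and [deg b], so the
    degrees agree when [x] is aperiodic, and then unique factorization
    applies. *)
Lemma prefix_inj a b x : aperiodic_path x -> prefix a x = prefix b x -> a = b.
Proof.
move=> ax e; have dab : deg a = deg b.
  apply: contrapT => dab; apply: (ax _ _ (nesym dab)).
  rewrite -{1}(shift_prefix a x) e shift_shift addrC.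
  by rewrite -shift_shift shift_prefix.
by rewrite -(initial_segment_prefix a x) e dab initial_segment_prefix.
Qed.

Lemma aperiodic_prefix mu x : aperiodic_path x -> aperiodic_path (prefix mu x).
Proof.
move=> ax m n mn e; apply: (ax _ _ mn).
by rewrite -(shift_prefix mu x) !shift_shift ![deg mu + _]addrC -!shift_shift e.
Qed.

Lemma cylinder_open mu : open (cylinder mu : set (infpath L)).
Proof.
exists [set cylinder mu]; last by rewrite bigcup_set1.
by move=> _ ->; apply: finI_from1; exists mu.
Qed.

(** Cylinders of two initial segments of [x] intersect in a set containing the
    cylinder of any longer initial segment, so the subbase of all cylinders
    gives neighbourhood bases of cylinders at [x]. *)
Lemma nbhs_pathP x (A : set (infpath L)) : nbhs x A <->
  exists n, [set y | initial_segment y n = initial_segment x n] `<=` A.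
Proof.
split=> [|[n nA]]; last first.
  apply: filterS nA _; apply: open_nbhs_nbhs; split=> //.
  have := cylinder_open (initial_segment x n).
  by rewrite cylinderE deg_initial_segment.
rewrite nbhsE => -[B [[D DB <-] [C DC Cx] BA]].
pose N : set_system (infpath L) := [set E | exists n,
  [set y | initial_segment y n = initial_segment x n] `<=` E].
have NF : Filter N.
  split=> [|E E' [n nE] [n' nE']|E E' EE' [n nE]]; first by exists 0.
    exists (n + n') => y /= yx; split.
      by apply: nE; apply: initial_segment_le yx; exact: dle_addr.
    by apply: nE'; apply: initial_segment_le yx; rewrite addrC; exact: dle_addr.
  by exists n => y /nE /EE'.
suff : N A by [].
apply: (@filterS _ N _ C) => [y Cy|]; first by apply: BA; exists C.
have [F FD FC] := DB _ DC.
move: Cx; rewrite -FC => Cx; apply: filter_bigI => E EF.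
have /set_mem[mu _ muE] := FD _ EF; have := Cx _ EF.
rewrite -muE /= cylinderE => xmu; exists (deg mu) => y /=.
by rewrite xmu.
Qed.

Lemma nbhs_initial_segment x n :
  \forall y \near x, initial_segment y n = initial_segment x n.
Proof. by apply/nbhs_pathP; exists n. Qed.

Lemma infpath_hausdorff : hausdorff_space (infpath L).
Proof.
move=> x y xy; apply: initial_segment_inj => n.
have [z [/= <- <-]] :=
  xy _ _ (nbhs_initial_segment x n) (nbhs_initial_segment y n).
by [].
Qed.

(** Aperiodicity depends on tails only, so one aperiodic path can be prefixed by
    any morphism. *)
Lemma aperiodic_dense x (A : set (infpath L)) : aperiodic L -> nbhs x A ->
  exists2 z, A z & aperiodic_path z.
Proof.
move=> apL /nbhs_pathP[n nA].
have [y [_ ay]] := apL _ (vertex_rng (initial_segment x n)).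
exists (prefix (initial_segment x n) y); last exact: aperiodic_prefix.
apply: nA; rewrite /= -{2}(deg_initial_segment x n).
exact: initial_segment_prefix.
Qed.

Lemma finite_paths_of_degree n : row_finite L ->
  finite_set (paths_of_degree n : set L).
Proof.
move=> rf; have [v vE] := sv; have vv : vertices v by rewrite vE.
apply: sub_finite_set (rf v n vv) => mu mun; split=> //.
exact: (single_vertex_eq sv (vertex_rng mu) vv).
Qed.

(** An ultrafilter of paths selects, by row-finiteness, one value at each
    morphism of [Omega]; every functor law involves finitely many of these
    values, so it is inherited from some path. *)
Lemma infpath_compact : row_finite L -> compact [set: infpath L].
Proof.
move=> rf; rewrite compact_ultra => F FU _.
have ex (a : Omega k) : exists s, F [set x : infpath L | x a = s].
  apply: (@ultra_finite _ _ _ (fun x : infpath L => x a)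
    (paths_of_degree (deg a))).
    exact: finite_paths_of_degree.
  by move=> x; exact: fct_deg.
have [f fP] := choice ex.
have f_rng (a : Omega k) : f (rng a) = rng (f a).
  have [x [/= <- <-]] := filter_ex (filterI (fP (rng a)) (fP a)).
  exact: fct_rng.
have f_src (a : Omega k) : f (src a) = src (f a).
  have [x [/= <- <-]] := filter_ex (filterI (fP (src a)) (fP a)).
  exact: fct_src.
have f_comp (a b : Omega k) : src a = rng b -> f (comp a b) = comp (f a) (f b).
  move=> ab.
  have [x [/= <- [<- <-]]] :=
    filter_ex (filterI (fP (comp a b)) (filterI (fP a) (fP b))).
  exact: fct_comp.
have f_deg (a : Omega k) : deg (f a) = deg a.
  by have [x /= <-] := filter_ex (fP a); exact: fct_deg.
exists (Functor f_rng f_src f_comp f_deg); split=> // A /nbhs_pathP[n nA].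
by apply: filterS nA _; exact: fP.
Qed.

End SingleVertexPaths.

(** * The stabilizer URS of an action with clopen germ sets *)

Section StabilizerURS.
Variables (G : groupType) (X : topologicalType) (act : G -> X -> X).
Local Open Scope group_scope.
Implicit Types (g h : G) (x y : X) (chi : {ptws G -> bool}).
Implicit Types (T : set {ptws G -> bool}).

Hypothesis act1 : forall x, act 1 x = x.
Hypothesis actM : forall g h x, act (g * h) x = act g (act h x).
Hypothesis act_continuous : forall g, continuous (act g).
Hypothesis X_compact : compact [set: X].
Hypothesis X_hausdorff : hausdorff_space X.
Hypothesis orbit_dense : forall x y (A : set X), nbhs y A ->
  exists g, A (act g x).
Hypothesis germ_closed : forall g, closed [set x | germ_stabilizer act x g].
Variable z : X.
Hypothesis z_free : stabilizer act z = germ_stabilizer act z.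

Local Notation germ_indicator x := (indicator (germ_stabilizer act x)).

Lemma germ_stabilizer_act g h x : germ_stabilizer act (act g x) h <->
  germ_stabilizer act x (g^-1 * h * g).
Proof.
rewrite /germ_stabilizer /=; split=> [/(act_continuous (x := x)) hx|hx].
  apply: filterS (hx : nbhs x (act g @^-1` _)) => y /= hy.
  by rewrite !actM hy -actM mulVg act1.
have : nbhs (act g^-1 (act g x)) [set y | act (g^-1 * h * g) y = y].
  by rewrite -actM mulVg act1.
move=> /(act_continuous (x := act g x)) hgx.
apply: filterS (hgx : nbhs (act g x) (act g^-1 @^-1` _)) => y /=.
by move=> /(congr1 (act g)); rewrite -!actM !mulgA mulgV mul1g mulgK act1.
Qed.

Lemma stabilizer_act g h x : stabilizer act (act g x) h <->
  stabilizer act x (g^-1 * h * g).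
Proof.
rewrite /stabilizer /= !actM; split=> [->|/(congr1 (act g))].
  by rewrite -actM mulVg act1.
by rewrite -[in LHS]actM mulgV act1.
Qed.

Lemma germ_indicator_act g x :
  germ_indicator (act g x) = conj_subset g (germ_indicator x).
Proof.
by apply/funext => h; apply: asbool_equiv_eq; exact: germ_stabilizer_act.
Qed.

Lemma germ_stabilizer_subgroup x : is_subgroup (germ_stabilizer act x).
Proof.
split=> [|g h gx hx|g gx]; first by apply: nearW => y; exact: act1.
  by apply: filterS2 gx hx => y gy hy; rewrite actM hy.
by apply: filterS gx => y gy; rewrite -{1}gy -actM mulVg act1.
Qed.

Lemma germ_stabilizer_sub x : germ_stabilizer act x `<=` stabilizer act x.
Proof. by move=> g /nbhs_singleton. Qed.

Lemma free_act g : stabilizer act (act g z) = germ_stabilizer act (act g z).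
Proof.
apply/seteqP; split=> h; last exact: germ_stabilizer_sub.
by move=> /stabilizer_act; rewrite z_free => /germ_stabilizer_act.
Qed.

Lemma closed_invariant_setT (A : set X) : closed A -> A !=set0 ->
  (forall g x, A x -> A (act g x)) -> A = setT.
Proof.
move=> cA [a Aa] iA; apply/seteqP; split=> // x _; apply: cA => B xB.
by have [g Bg] := orbit_dense a xB; exists (act g a); split=> //; exact: iA.
Qed.

Lemma germ_open g : open [set x | germ_stabilizer act x g].
Proof. exact: open_interior. Qed.

Lemma germ_indicator_continuous :
  continuous (fun x => germ_indicator x : {ptws G -> bool}).
Proof.
apply: continuous_to_ptws => g x.
have [gx|gx] := pselect (germ_stabilizer act x g).
  apply: filterS (open_nbhs_nbhs (conj (germ_open g) gx)) => y gy.
  by rewrite /indicator !asboolT.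
have := open_nbhs_nbhs (conj (closed_openC (@germ_closed g)) gx).
by apply: filterS => y gy; rewrite /indicator !asboolF.
Qed.

(** This relation contains the graph of [stabilizer] and is closed, because
    having a trivial germ is an open condition on points and being fixed is a
    closed one; so its projection contains all limits of stabilizers. *)
Definition between : set (X * {ptws G -> bool}) :=
  [set p : X * {ptws G -> bool} | forall g,
    (germ_stabilizer act p.1 g -> p.2 g) /\ (p.2 g -> stabilizer act p.1 g)].

Lemma between_stabilizer x : between (x, indicator (stabilizer act x)).
Proof.
by move=> g; split=> [/germ_stabilizer_sub gx|/asboolP //]; exact/asboolP.
Qed.

Lemma between_germ_stabilizer x : between (x, germ_indicator x).
Proof.
by move=> g; split=> [gx|/asboolP/germ_stabilizer_sub //]; exact/asboolP.
Qed.

Lemma between_act g x chi : between (x, chi) ->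
  between (act g x, conj_subset g chi).
Proof.
move=> xchi h; have [xc cx] := xchi (g^-1 * h * g); split=> /=.
  by move=> /germ_stabilizer_act.
by move=> /cx ?; exact/stabilizer_act.
Qed.

Lemma between_free chi : between (z, chi) -> chi = germ_indicator z.
Proof.
move=> zchi; apply/funext => g; have [zc cz] := zchi g.
apply/idP/asboolP => //.
by move=> /cz; rewrite z_free.
Qed.

Lemma between_closed : closed between.
Proof.
have fstc : continuous (@fst X {ptws G -> bool}) by move=> p; exact: cvg_fst.
have sndc : continuous (@snd X {ptws G -> bool}) by move=> p; exact: cvg_snd.
have coordc g (b : bool) : closed [set p : X * {ptws G -> bool} | p.2 g = b].
  apply: ((continuous_closedP _).1 sndc
    [set chi : {ptws G -> bool} | chi g = b]).
  apply: ((continuous_closedP _).1 (@coordinate_continuous _ g) [set b]).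
  exact: discrete_closed.
have -> : between = \bigcap_g
    ((fst @^-1` (~` [set x | germ_stabilizer act x g]) `|`
      [set p | p.2 g = true])
  `&` ([set p | p.2 g = false] `|` fst @^-1` [set x | act g x = x])).
  apply/seteqP; split=> [p pb g _|p pb g]; last first.
    have [[pg|pg] [pg'|pg']] := pb g I; split=> //; by rewrite pg'.
  have [pg gp] := pb g; split.
    by have [/pg|?] := pselect (germ_stabilizer act p.1 g); [right|left].
  by case E : (p.2 g); [right; exact: gp|left].
(* Germ sets are open, which closes the first factor, and fixed-point sets are
   closed, which closes the second. *)
apply: closed_bigI => g _; apply: closedI; apply: closedU => //.
  apply: ((continuous_closedP _).1 fstc); apply: open_closedC.
  exact: germ_open.
apply: ((continuous_closedP _).1 fstc).
exact: closed_fixpoints.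
Qed.

Lemma between_compact T : closed T -> compact (between `&` snd @^-1` T).
Proof.
move=> cT; apply: (@subclosed_compact _ _ setT) => //.
  apply: closedI; first exact: between_closed.
  by apply: (continuous_closedP _).1 cT => p; exact: cvg_snd.
rewrite -setXTT; apply: compact_setX => //.
exact: ptws_bool_compact.
Qed.

(** The points over which a closed invariant [T] has an element form a closed
    invariant set, hence all of [X], including the free point [z], over which
    there is only one candidate. *)
Lemma closed_invariant_free T : closed T -> T !=set0 -> conj_invariant T ->
  (forall chi, T chi -> exists x, between (x, chi)) -> T (germ_indicator z).
Proof.
move=> cT [chi0 T0] iT Tb.
pose P := fst @` (between `&` snd @^-1` T).
suff PT : P = setT.
  have [[x chi] [b Tchi] /= xz] : P z by rewrite PT.
  by move: b; rewrite xz => /between_free <-.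
apply: closed_invariant_setT.
- apply: compact_closed => //; apply: continuous_compact.
    by apply: continuous_subspaceT => p; exact: cvg_fst.
  exact: between_compact.
- by have [x b] := Tb _ T0; exists x, (x, chi0).
- move=> g _ [[x chi] [b Tchi] <-]; exists (act g x, conj_subset g chi) => //.
  by split; [exact: between_act|exact: iT].
Qed.

Lemma closed_invariant_germ T : closed T -> conj_invariant T ->
  T (germ_indicator z) -> range (fun x => germ_indicator x) `<=` T.
Proof.
move=> cT iT Tz.
suff PT : [set x | T (germ_indicator x)] = setT.
  by move=> _ [x _ <-]; have : [set: X] x by []; rewrite -PT.
apply: closed_invariant_setT; last 1 first.
- by move=> g x Tx; rewrite /= germ_indicator_act; exact: iT.
- exact: ((continuous_closedP _).1 germ_indicator_continuous _ cT).
- by exists z.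
Qed.

Lemma germ_range_closed :
  closed (range (fun x => germ_indicator x) : set {ptws G -> bool}).
Proof.
apply: compact_closed; first exact: ptws_bool_hausdorff.
apply: continuous_compact => //; apply: continuous_subspaceT.
exact: germ_indicator_continuous.
Qed.

Lemma germ_range_invariant :
  conj_invariant (range (fun x => germ_indicator x)).
Proof.
by move=> g _ [x _ <-]; exists (act g x) => //; exact: germ_indicator_act.
Qed.

Lemma germ_range_URS : is_URS (range (fun x => germ_indicator x)).
Proof.
split.
- move=> _ [x _ <-]; exists (germ_stabilizer act x) => //.
  exact: germ_stabilizer_subgroup.
- by exists (germ_indicator z), z.
- exact: germ_range_closed.
- exact: germ_range_invariant.
move=> T TS T0 cT iT; apply/seteqP; split=> //.
apply: closed_invariant_germ => //; apply: closed_invariant_free => //.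
by move=> _ /TS [x _ <-]; exists x; exact: between_germ_stabilizer.
Qed.

(** The orbit of [z] is dense and consists of points whose stabilizer is the
    germ stabilizer, and germ stabilizers vary continuously. *)
Lemma germ_range_closure : range (fun x => germ_indicator x) `<=`
  closure (range (fun x => indicator (stabilizer act x))
    : set {ptws G -> bool}).
Proof.
move=> _ [x _ <-] U /germ_indicator_continuous xU.
have [g Ug] := orbit_dense z xU.
exists (germ_indicator (act g z)); split=> //.
by exists (act g z) => //; rewrite free_act.
Qed.

(** [between] is closed and the projection along the compact space [X] is a
    closed map. *)
Lemma closure_between chi :
  closure (range (fun x => indicator (stabilizer act x))
    : set {ptws G -> bool}) chi ->
  exists x, between (x, chi).
Proof.
have cb : closed (snd @` between : set {ptws G -> bool}).
  apply: compact_closed; first exact: ptws_bool_hausdorff.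
  apply: continuous_compact.
    by apply: continuous_subspaceT => p; exact: cvg_snd.
  by have := between_compact (@closedT _); rewrite preimage_setT setIT.
move=> chic; suff [[x chi'] b /= e] : (snd @` between) chi.
  by exists x; rewrite -e.
apply: cb; apply: closureS chic => _ [x _ <-].
by exists (x, indicator (stabilizer act x)) => //; exact: between_stabilizer.
Qed.

(** Any other URS made of limits of stabilizers contains the range of the germ
    stabilizers, by [closed_invariant_free] and [closed_invariant_germ], and
    its own minimality makes the two equal. *)
Lemma stabilizer_URS_germ :
  is_stabilizer_URS act (range (fun x => germ_indicator x)).
Proof.
split; first by split; [exact: germ_range_URS|exact: germ_range_closure].
move=> S [[_ S0 cS iS minS] Sc]; apply: minS => //.
- apply: closed_invariant_germ => //; apply: closed_invariant_free => //.
  by move=> chi /Sc; exact: closure_between.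
- by exists (germ_indicator z), z.
- exact: germ_range_closed.
- exact: germ_range_invariant.
Qed.

End StabilizerURS.

(** * Unitaries in the algebra of a single-vertex graph *)

Section GraphAlgebra.
Variables (R : realType) (k : nat) (L : kgraph k) (O : graph_algebra R L).
Hypothesis sv : single_vertex L.
Local Open Scope ring_scope.
Implicit Types (l : seq (L * L)) (mu nu : L) (n : degree k).

Local Notation s := (@gen R k L O).

Lemma gen0_trivial mu : s mu = 0 -> forall a : O, a = 0.
Proof.
move=> mu0 a; have v0 : s (the_vertex sv) = 0.
  rewrite (single_vertex_eq sv (the_vertexP sv) (vertex_src mu)).
  by rewrite -(ck_src (gen_ck O)) mu0 cmul0r.
by rewrite -(gen_vertex_unit sv a).1 v0 cmul0l.
Qed.

Lemma ht_sum_refine_r l n : source_matching l ->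
  (forall p, p \in l -> dle (deg p.2) n) ->
  exists l', [/\ source_matching l', ht_sum O l' = ht_sum O l &
    forall p, p \in l' -> deg p.2 = n].
Proof.
move=> sl ln.
have [_ /mapP[p pl ->]|m [sm em dm]] :=
    ht_sum_refine O (n := n) (source_matching_swap sl); first exact: ln.
exists [seq (p.2, p.1) | p <- m]; split; first exact: source_matching_swap.
  by rewrite -ht_sum_star em -ht_sum_star starK.
by move=> _ /mapP[p pm ->]; exact: dm.
Qed.

(** Composition of the two rewriting rules: if all second components of [l] and
    all first components of [l'] have one common degree, then distinct ones are
    orthogonal, and this presents the product of the two sums. *)
Definition pair_comp l l' : seq (L * L) :=
  [seq (p.1, q.2) | p <- l, q <- [seq q <- l' | q.1 == p.2]].

Lemma pair_comp_matching l l' : source_matching l -> source_matching l' ->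
  source_matching (pair_comp l l').
Proof.
move=> sl sl' _ /allpairsPdep [p [q [pl + ->]]] /=.
by rewrite mem_filter => /andP[/eqP pq ql']; rewrite sl // -pq sl'.
Qed.

Lemma ht_sum_pair_comp l l' n : source_matching l ->
  (forall p, p \in l -> deg p.2 = n) -> (forall q, q \in l' -> deg q.1 = n) ->
  ht_sum O l ** ht_sum O l' = ht_sum O (pair_comp l l').
Proof.
move=> sl ln l'n; rewrite /ht_sum cmul_suml big_allpairs_dep /=.
rewrite big_seq [RHS]big_seq; apply: eq_bigr => p pl.
rewrite cmul_sumr big_filter [RHS]big_mkcond /=.
rewrite big_seq [RHS]big_seq; apply: eq_bigr => q ql'.
rewrite cmulA -[_ ** _ ** s q.1]cmulA; case: eqP => [->|/nesym pq].
  by rewrite (ck_src (gen_ck O)) -sl // gen_mul_src.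
suff -> : star (s p.2) ** s q.1 = 0 by rewrite cmul0r cmul0l.
apply: gen_orthogonal => //; last by rewrite ln // l'n.
exact: (single_vertex_eq sv (vertex_rng _) (vertex_rng _)).
Qed.

(** Otherwise [U] would kill the range of [s nu] for a long initial segment
    [nu] of [x]. *)
Lemma unitary_cover (U : O) l x : (forall mu, s mu <> 0) -> unitary U ->
  U = ht_sum O l ->
  exists2 p, p \in l & initial_segment x (deg p.2) = p.2.
Proof.
move=> s0 [u1 _] Ul; apply: contrapT => none.
have [n ln] := degree_bound [seq p.2 | p <- l].
apply: (s0 (initial_segment x n)).
rewrite -[LHS](u1 (s (initial_segment x n))).1 -cmulA.
suff -> : U ** s (initial_segment x n) = 0 by exact: cmul0r.
rewrite Ul /ht_sum cmul_suml big_seq big1 // => p pl.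
have /dsubK <- : dle (deg p.2) n by apply: ln; exact: map_f.
rewrite initial_segmentD (ck_comp (gen_ck O)); last exact: src_eq_rng.
rewrite -cmulA [X in _ ** X]cmulA gen_orthogonal ?cmul0l ?cmul0r //.
- exact: (single_vertex_eq sv (vertex_rng _) (vertex_rng _)).
- by rewrite deg_initial_segment.
- by move=> e; apply: none; exists p.
Qed.

(** The element of the group that rewrites initial segments of degree [n] by
    [tau]; as [tau] is an involution, so is this element, and one computation
    settles both unitarity relations. *)
Lemma ht_involution n (tau : L -> L) : (forall mu, s mu <> 0) ->
  involutive tau -> (forall mu, deg mu = n -> deg (tau mu) = n) ->
  exists (U : ht_type O sv) l, [/\ source_matching l, ht_val U = ht_sum O l &
    forall mu, deg mu = n -> (tau mu, mu) \in l].
Proof.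
move=> s0 tauK taun.
have [r [ur rP rE r0]] := vertex_sum O n (the_vertexP sv).
have rn mu : (mu \in r) = (deg mu == n).
  apply/idP/eqP => [/rP[]//|mun]; apply/negP => /negP/r0 mu0.
  apply: (s0 mu); apply: mu0; split=> //.
  exact: (single_vertex_eq sv (vertex_rng _) (the_vertexP sv)).
have ptau : perm_eq [seq tau mu | mu <- r] r.
  apply: uniq_perm => //; first by rewrite map_inj_uniq //; exact: inv_inj.
  move=> mu; rewrite -{1}(tauK mu) mem_map ?rn; last exact: inv_inj.
  by apply/eqP/eqP => /taun; rewrite ?tauK.
pose l := [seq (tau mu, mu) | mu <- r].
have sl : source_matching l.
  move=> _ /mapP[mu _ ->] /=.
  exact: (single_vertex_eq sv (vertex_src _) (vertex_src _)).
have starl : star (ht_sum O l) = ht_sum O l.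
  rewrite ht_sum_star /ht_sum !big_map -(perm_big _ ptau) big_map.
  by apply: eq_bigr => mu _; rewrite /= tauK.
have ll : ht_sum O l ** ht_sum O l = s (the_vertex sv).
  rewrite -{2}starl ht_sum_star /ht_sum rE -(perm_big _ ptau) !big_map.
  rewrite cmul_suml big_seq [RHS]big_seq; apply: eq_bigr => mu mur /=.
  rewrite cmul_sumr (bigD1_seq mu) //=.
  rewrite [X in _ + X]big_seq_cond big1; last first.
    move=> nu /andP[nur /eqP num].
    rewrite cmulA -[_ ** _ ** s nu]cmulA gen_orthogonal ?cmul0r ?cmul0l //.
    - exact: (single_vertex_eq sv (vertex_rng _) (vertex_rng _)).
    - by move: mur nur; rewrite !rn => /eqP -> /eqP ->.
    - exact: nesym.
  rewrite addr0 cmulA -[_ ** _ ** s mu]cmulA (ck_src (gen_ck O)).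
  rewrite (single_vertex_eq sv (vertex_src mu) (vertex_src (tau mu))).
  by rewrite gen_mul_src.
have htl : in_ht (ht_sum O l).
  split; last by exists l.
  by rewrite /unitary starl ll; split; exact: gen_vertex_unit.
exists (Ht sv htl), l; split=> // mu mun.
by apply/mapP; exists mu => //; rewrite rn mun.
Qed.

End GraphAlgebra.

(** * The action on infinite paths *)

Section Action.
Variables (R : realType) (k : nat) (L : kgraph k) (O : graph_algebra R L).
Variable sv : single_vertex L.
Variable phi : ht_type O sv -> infpath L -> infpath L.
Hypothesis k_gt0 : (0 < k)%N.
Hypothesis apL : aperiodic L.
Hypothesis phiE : ht_canonical_action phi.
Local Open Scope ring_scope.
Implicit Types (U V : ht_type O sv) (l : seq (L * L)) (x y z : infpath L).
Implicit Types (mu nu : L) (m n : degree k).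

Lemma phi_prefix U l alpha beta y : source_matching l ->
  ht_val U = ht_sum O l -> (alpha, beta) \in l ->
  phi U (prefix beta y) = prefix alpha y.
Proof.
by move=> sl Ul abl; apply: phiE sl Ul _ _ abl _ _; exact: origin_eq_src.
Qed.

Lemma aperiodic_path_ex : exists x : infpath L, aperiodic_path x.
Proof. by have [x [_ ax]] := apL (the_vertexP sv); exists x. Qed.

(** In the zero algebra a single unitary would have all the presentations
    [s alpha ** star (s v)], and [phi] could not follow them all. *)
Lemma gen_neq0 mu : gen O mu <> 0.
Proof.
move=> /(gen0_trivial sv) O0; have [y ay] := aperiodic_path_ex.
(* Any nonzero degree would do; there is one because the rank is positive. *)
pose n : degree k := [ffun=> 1%N]; pose v := the_vertex sv.
have pE alpha : phi 1%g (prefix v y) = prefix alpha y.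
  apply: (@phi_prefix _ [:: (alpha, v)]); last by rewrite inE.
    move=> p; rewrite inE => /eqP -> /=.
    exact: (single_vertex_eq sv (vertex_src _) (vertex_src _)).
  by rewrite [LHS]O0 [RHS]O0.
have vE : v = initial_segment y n.
  by apply: (prefix_inj sv ay); exact: (etrans (esym (pE v)) (pE _)).
have : deg v = 0 := the_vertexP sv; rewrite vE deg_initial_segment.
by move=> /ffunP/(_ (Ordinal k_gt0)); rewrite !ffunE.
Qed.

Lemma ht_cover U l x : ht_val U = ht_sum O l ->
  exists2 p, p \in l & initial_segment x (deg p.2) = p.2.
Proof.
have [uU _] := ht_valP U.
exact: (unitary_cover sv x gen_neq0 uU).
Qed.

Lemma phi1 x : phi 1%g x = x.
Proof.
have [ee se] := ck_proj (gen_ck O) (the_vertexP sv).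
have xv : prefix (the_vertex sv) x = x.
  apply: prefix_vertex; apply: (single_vertex_eq sv (the_vertexP sv)).
  exact: deg_initial_segment.
rewrite -{1}xv -{2}xv.
apply: (@phi_prefix _ [:: (the_vertex sv, the_vertex sv)]).
- by move=> p; rewrite inE => /eqP ->.
- by rewrite /ht_sum big_seq1 /= se ee.
- by rewrite inE.
Qed.

(** Both elements are presented so that the segments written by [V] and those
    read by [U] have the same degree; the rules applying to [x] then compose. *)
Lemma phiM U V x : phi (U * V)%g x = phi U (phi V x).
Proof.
have [_ [l0 [sl0 Ul0]]] := ht_valP U; have [_ [l1 [sl1 Vl1]]] := ht_valP V.
have [n hn] := degree_bound ([seq p.2 | p <- l0] ++ [seq p.1 | p <- l1]).
have [p pl|l [sl el dl]] := ht_sum_refine_r O (n := n) sl0.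
  by apply: hn; rewrite mem_cat (map_f (fun p => p.2) pl).
have [p pl|l' [sl' el' dl']] := ht_sum_refine O (n := n) sl1.
  by apply: hn; rewrite mem_cat (map_f (fun p => p.1) pl) orbT.
rewrite -el in Ul0; rewrite -el' in Vl1.
have [[a' b'] pl' /= xb'] := ht_cover x Vl1.
have [[a b] pl /= xb] := ht_cover (phi V x) Ul0.
have [y {xb'} xE] : exists y, x = prefix b' y.
  by exists (shift (deg b') x); rewrite -{1}xb' prefix_shift.
subst x; rewrite (phi_prefix y sl' Vl1 pl') in xb *.
have ba' : b = a'.
  rewrite -xb /= (dl _ pl) -(dl' _ pl') /=.
  exact: initial_segment_prefix.
subst b; rewrite (phi_prefix y sl Ul0 pl).
apply: (@phi_prefix _ (pair_comp l l')).
- exact: pair_comp_matching.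
- by rewrite /= Ul0 Vl1; exact: (ht_sum_pair_comp O sv sl dl dl').
- apply/allpairsPdep; exists (a, a'), (a', b'); split=> //.
  by rewrite mem_filter eqxx.
Qed.

(** A presentation of [U] has a term that reads an initial segment of [x], by
    [ht_cover]; prolonging both components of this term makes it read the
    initial segment of any larger degree. *)
Lemma phi_local U x : exists m, forall n, dle m n -> exists alpha,
  forall z, initial_segment z n = initial_segment x n ->
    phi U z = prefix alpha (shift n z).
Proof.
have [_ [l [sl Ul]]] := ht_valP U; have [[a b] pl /= xb] := ht_cover x Ul.
exists (deg b) => n /dsubK; set d := dsub n _ => <-.
exists (comp a (initial_segment (shift (deg b) x) d)) => z.
move=> /initial_segmentD_inj[zb zd].
rewrite prefix_comp // -zd -shift_shift prefix_shift.
by rewrite -(phi_prefix _ sl Ul pl) -{1}xb -zb prefix_shift.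
Qed.

Lemma phi_continuous U : continuous (phi U).
Proof.
move=> x A /nbhs_pathP - /(_ sv) [n nA].
have [m /(_ (m + n) (dle_addr m n)) [a aE]] := phi_local U x.
(* The rule of [aE] applies to paths agreeing with [x] up to [m + n]; the other
   [n] makes the tails that it keeps agree up to [n]. *)
apply/(nbhs_pathP sv); exists (m + n + n) => z /= zx.
have [zx1 zx2] := initial_segmentD_inj zx.
apply: nA => /=; rewrite !aE //.
apply: (@initial_segment_le _ _ _ _ _ (deg a + n)).
  by rewrite addrC; exact: dle_addr.
by rewrite !initial_segment_prefixD // zx2.
Qed.

(** Near [x], both elements rewrite the same initial segment.  Either they
    rewrite it in the same way, or, by [prefix_inj], they differ at every
    aperiodic path. *)
Lemma germ_dichotomy U V x :
  (\forall z \near x, phi U z = phi V z) \/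
  (\forall z \near x, aperiodic_path z -> phi U z <> phi V z).
Proof.
have [m mE] := phi_local U x; have [n nE] := phi_local V x.
have [a aE] := mE _ (dle_addr m n).
have [|b bE] := nE (m + n); first by rewrite addrC; exact: dle_addr.
have near_x := nbhs_initial_segment sv x (m + n).
have [ab|ab] := pselect (a = b); [left|right]; apply: filterS near_x => z zx.
  by rewrite aE // bE // ab.
rewrite aE // bE // => az e; apply: ab.
by apply: (prefix_inj sv _ e); exact: aperiodic_shift.
Qed.

(** Where the germ of [U] is nontrivial, [germ_dichotomy] leaves its second
    alternative only, and that one keeps germs nontrivial near [x]. *)
Lemma germ_stabilizer_closed U : closed [set x | germ_stabilizer phi x U].
Proof.
move=> x cx; have [Ux|Ux] := germ_dichotomy U 1%g x.
  by apply: filterS Ux => z ->; exact: phi1.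
rewrite -nbhs_nearE in Ux; have [y [/= Uy xy]] := cx _ (nbhs_interior Ux).
have [z [zy zU] az] := aperiodic_dense sv apL (filterI Uy xy).
by have := zU az; rewrite phi1.
Qed.

(** An element fixing an aperiodic path agrees there with the identity, which
    excludes the second alternative of [germ_dichotomy]. *)
Lemma aperiodic_free z : aperiodic_path z ->
  stabilizer phi z = germ_stabilizer phi z.
Proof.
move=> az; apply/seteqP; split=> U; last exact: germ_stabilizer_sub.
move=> Uz; have [Ux|/nbhs_singleton] := germ_dichotomy U 1%g z.
  by apply: filterS Ux => y ->; exact: phi1.
by move=> /(_ az); rewrite phi1.
Qed.

(** Exchange the initial segments of [x] and [y] of a large degree. *)
Lemma phi_orbit_dense x y (A : set (infpath L)) : nbhs y A ->
  exists U, A (phi U x).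
Proof.
move=> /(nbhs_pathP sv)[n nA].
pose mu := initial_segment x n; pose nu := initial_segment y n.
pose tau la := if la == mu then nu else if la == nu then mu else la.
have tauK : involutive tau.
  move=> la; rewrite /tau; have [->|lamu] := eqVneq la mu.
    by rewrite eqxx; case: eqVneq.
  have [->|lanu] := eqVneq la nu; first by rewrite eqxx.
  by rewrite (negPf lamu) (negPf lanu).
have taun la : deg la = n -> deg (tau la) = n.
  by rewrite /tau; do 2?case: ifP => _ //; rewrite deg_initial_segment.
have [U [l [sl Ul lP]]] := ht_involution sv gen_neq0 tauK taun.
exists U; apply: nA => /=; rewrite -(prefix_shift x n) -/mu.
rewrite (phi_prefix _ sl Ul (lP mu (deg_initial_segment x n))) /tau eqxx.
have := initial_segment_prefix sv nu (shift n x).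
by rewrite deg_initial_segment.
Qed.

Lemma germ_eq U V x y : germ phi U x = germ phi V y <->
  x = y /\ \forall z \near x, phi U z = phi V z.
Proof.
split=> [/eqmodP/asboolP //|h].
by apply/eqmodP/asboolP.
Qed.

Lemma germ_basic_nbhs U x (A : set (infpath L)) : nbhs x A ->
  nbhs (germ phi U x) [set germ phi U z | z in A].
Proof.
rewrite nbhsE => -[B [oB Bx] BA].
apply: (@filterS _ _ _ [set germ phi U z | z in B]).
  by move=> _ [z Bz <-]; exists z => //; exact: BA.
apply: open_nbhs_nbhs; split; last by exists x.
exists [set [set germ phi U z | z in B]]; last by rewrite bigcup_set1.
by move=> _ ->; apply: finI_from1; exists U, B.
Qed.

(** If two germs cannot be separated, their base points cannot be separated
    either, hence agree, and there are points [z] arbitrarily close to the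
    common base point [x] at which [U] and [V] have the same germ.  Aperiodic
    paths near [z] exclude the second alternative of [germ_dichotomy] at [x]. *)
Lemma phi_hausdorff_germs : hausdorff_germs phi.
Proof.
move=> p q; have [[U x] ->] : exists Ux, p = germ phi Ux.1 Ux.2.
  by exists (repr p); rewrite -[LHS]reprK; case: (repr p).
have [[V y] ->] /= : exists Vy, q = germ phi Vy.1 Vy.2.
  by exists (repr q); rewrite -[LHS]reprK; case: (repr q).
move=> UVxy; have meet (A B : set (infpath L)) : nbhs x A -> nbhs y B ->
    exists z, [/\ A z, B z & \forall t \near z, phi U t = phi V t].
  move=> /(germ_basic_nbhs U) xA /(germ_basic_nbhs V) yB.
  have [_ [[z Az <-] [t Bt]]] := UVxy _ _ xA yB.
  by move=> /esym/germ_eq[zt UV]; exists z; split=> //; rewrite zt.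
have xy : x = y.
  apply: (infpath_hausdorff sv) => A B xA yB.
  by have [z [Az Bz _]] := meet _ _ xA yB; exists z.
apply/germ_eq; split=> //; case: (germ_dichotomy U V x) => //.
rewrite -nbhs_nearE => Ux; rewrite -xy in meet.
have [z [zU _ zUV]] := meet _ _ (nbhs_interior Ux) filterT.
have [t [tU tUV] at_] := aperiodic_dense sv apL (filterI zU zUV).
by have := tU at_.
Qed.

End Action.

(** * Hausdorff germs and the stabilizer URS of the group *)

Theorem theorem5p7 (R : realType) (k : nat) (k_gt0 : (0 < k)%N)
    (L : kgraph k) (L_row_finite : row_finite L) (L_source_free : source_free L)
    (L_single_vertex : single_vertex L) (L_aperiodic : aperiodic L)
    (O : graph_algebra R L)
    (phi : ht_type O L_single_vertex -> infpath L -> infpath L)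
    (phiE : ht_canonical_action phi) :
  hausdorff_germs phi /\
  is_stabilizer_URS phi
    (range (fun x : infpath L => indicator (germ_stabilizer phi x))).
Proof.
split; first exact: phi_hausdorff_germs.
have [z az] := aperiodic_path_ex L_single_vertex L_aperiodic.
apply: (@stabilizer_URS_germ _ _ _ _ _ _ _ _ _ _ z).
- exact: phi1.
- exact: phiM.
- exact: phi_continuous.
- exact: infpath_compact.
- exact: infpath_hausdorff.
- exact: phi_orbit_dense.
- exact: germ_stabilizer_closed.
- exact: aperiodic_free.
Qed.
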